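(* Let $G$ and $G'$ be countable groups, and let $\widetilde\mu$ be a probability measure on the product $\widetilde G=G\times G'$ with finite entropy $H(\widetilde\mu)<\infty$. Let $\mu$ and $\mu'$ be the marginal distributions of $\widetilde\mu$, i.e. its images under the coordinate projections onto $G$ and $G'$, respectively. Then $\widetilde\mu$ is Liouville if and only if both $\mu$ and $\mu'$ are Liouville.
   Context: For a probability measure $\mu$ on a countable group $G$ (with identity $e$), the random walk $(G,\mu)$ issued from $e$ is $g_t=h_1h_2\cdots h_t$, $g_0=e$, with $(h_t)$ i.i.d. $\mu$-distributed; let $\mathbf P$ be its law on $G^{\mathbb Z_+}$. The measure $\mu$ is called Liouville if the image of $\mathbf P$ on the Poisson boundary is a point mass, i.e. if every subset of $G^{\mathbb Z_+}$ invariant under the time shift $(g_0,g_1,\dots)\mapsto(g_1,g_2,\dots)$ has $\mathbf P$-measure $0$ or $1$. Equivalently, every bounded function $f$ on the set $S=\bigcup_{t\ge0}\operatorname{supp}\mu^{*t}$ of points attainable from $e$ (with $\mu^{*0}=\delta_e$) satisfying $f(g)=\sum_h\mu(h)f(gh)$ for all $g\in S$ is constant. No irreducibility of $\mu$ is assumed. The entropy is $H(\mu)=-\sum_g\mu(g)\log\mu(g)\in[0,\infty]$. *)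

(* Defs.v *)
From HB Require Import structures.
From mathcomp Require Import all_boot all_order all_algebra.
From mathcomp Require Import all_classical all_reals all_analysis.

Set Implicit Arguments.
Unset Strict Implicit.
Unset Printing Implicit Defensive.

Import Order.TTheory GRing.Theory Num.Theory.

Local Open Scope classical_set_scope.
Local Open Scope ring_scope.
Local Open Scope ereal_scope.

(* A copy of the group G carrying the sigma-algebra of all subsets. *)
Definition discrete_group (G : groupType) : Type := G.

Section discrete_instances.
Variable G : groupType.

HB.instance Definition _ := Group.on (discrete_group G).
HB.instance Definition _ := isPointed.Build (discrete_group G) (1%g : G).
HB.instance Definition _ := @isMeasurable.Build default_measure_display
  (discrete_group G) discrete_measurable discrete_measurable0
  discrete_measurableC discrete_measurableU.

End discrete_instances.

(* For a countable group this generates the product sigma-algebra of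
   G^{Z_+}. *)
Definition coordinate_sets (G : groupType) : set (set (nat -> discrete_group G)) :=
  [set C | exists n (A : set (discrete_group G)), C = [set w | A (w n)]].

Definition trajectories (G : groupType) :=
  g_sigma_algebraType (@coordinate_sets G).

(* These values on the finite-dimensional rectangles determine Q, which is
   the infinite product of copies of mu. *)
Definition iid_law (R : realType) (G : groupType)
    (mu : probability (discrete_group G) R) (Q : probability (trajectories G) R) :=
  forall n (A : nat -> set (discrete_group G)),
    Q [set h | forall i, (i < n)%N -> A i (h i)] = \prod_(i < n) mu (A i).

(* The increments are numbered from 0: h i is the (i + 1)-st one. The group
   need not be commutative and the factors are in increasing order of i. *)
Definition walk (G : groupType) (h : trajectories G) : trajectories G :=
  fun t => (\big[*%g/1%g]_(i < t) h i)%g.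

Definition time_shift (G : groupType) (g : trajectories G) : trajectories G :=
  fun t => g t.+1.

(* The measure Q with iid_law mu Q exists and is unique (Kolmogorov), so
   quantifying over it amounts to speaking of the product measure; the law
   of the random walk issued from the identity is pushforward Q walk. *)
Definition Liouville (R : realType) (G : groupType)
    (mu : probability (discrete_group G) R) :=
  forall Q : probability (trajectories G) R, iid_law mu Q ->
  forall A : set (trajectories G), measurable A -> @time_shift G @^-1` A = A ->
    pushforward Q (@walk G) A = 0 \/ pushforward Q (@walk G) A = 1.

(* Points of mass 0 contribute 0 since lne 0 = -oo and 0 * -oo = 0. *)
Definition entropy (R : realType) (G : groupType)
    (mu : probability (discrete_group G) R) : \bar R :=
  \esum_(g in [set: discrete_group G]) - (mu [set g] * lne (mu [set g])).

(* Main.v *)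
Require Import Defs.
From HB Require Import structures.
From mathcomp Require Import all_boot all_order all_algebra.
From mathcomp Require Import all_classical all_reals all_analysis.
From mathcomp Require Import measurable_realfun.
From mathcomp Require Import ring lra.

(** Whether a measure is Liouville is governed by its entropy, and entropy is
subadditive for couplings.

Let p be a probability vector on a countable group and let H_n be the
entropy of its n-th convolution power, that is, of the position at time n.
The chain rule ([ent_cpowS]) says that H_(n+1) - H_n is the mutual
information between the first increment and the position at time n+1: the
sum over x of the quantities [info p n x], where [info p n x] is p x times
the relative entropy of the law of that position, given the first increment
x, with respect to its unconditional law. When H_1 is finite, relative
entropy and total variation control each other here: by the elementary
bounds [pinsker] and [kl_le_dist], [info p n x] is small exactly when the
distance [drift p n x] between the two laws is small, and by [info_le_ent]
the terms [info p n x] are dominated by a summable family.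

If every bounded harmonic function is trivial, then every drift tends to 0
([drift_cvg0]), so H_(n+1) - H_n tends to 0 and H_n = o(n)
([ent_sublinear]). The law on the product group is a coupling of its
marginals, and so are the convolution powers; hence its entropies are at
most the sums of the entropies of the marginals ([ent_joint_le]) and are
o(n) too. But each information [info p n x] bounds H_(n+1) - H_n from below,
so for each x the informations cannot stay away from 0, and neither can the
drifts ([drift_inf0]). As a harmonic function f with values in [0, 1]
satisfies f x <= f 1 + drift p n x for all n, it is trivial:
[trivial_harmonic_product].

One obstruction is periodicity: the drift compares times n and n+1, and a
nontrivial limit of the drifts produces a priori only a space-time harmonic
function. All of the above is therefore carried out for the lazy walks, which
stay put with probability 1/2. They have the same harmonic functions, and a
bounded space-time harmonic function of a lazy walk is independent of time
([choquet_deny]).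

It remains to relate harmonic functions to shift-invariant events. If they
are trivial, an invariant event is independent of every finite set of
increments, hence of itself ([shift_invariant_zero_one]). Conversely, if
f x1 < t < f x2, the event that f is at least t at infinitely many times
has probability less than 1 from x1, by the maximal inequality [ville], and
positive probability from x2 ([trivial_harmonic_of_zero_one]).

In the other direction of the theorem, the product walk projects onto its
coordinates, and invariant events of a coordinate walk pull back
([Liouville_image]). This uses the existence of i.i.d. sequences with a given
law on a countable set, obtained in [iid_exists] from the digits of a uniform
point of the unit interval. *)

Set Implicit Arguments.
Unset Strict Implicit.
Unset Printing Implicit Defensive.

Import Order.TTheory GRing.Theory Num.Theory.
Import numFieldNormedType.Exports.

Local Open Scope classical_set_scope.
Local Open Scope ring_scope.
Local Open Scope ereal_scope.

Local Notation "\esum_ x F" := (\esum_(x in [set: _]) F)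
  (at level 41, x ident, F at level 41) : ereal_scope.

(** * Sums of nonnegative families *)

Section sums.
Context {R : realType}.

Lemma esumZ (T : choiceType) (I : set T) (c : R) (F : T -> \bar R) :
  (0 <= c)%R -> (forall x, 0 <= F x) ->
  \esum_(x in I) (c%:E * F x) = c%:E * \esum_(x in I) F x.
Proof.
move=> c0 F0.
have le (d : R) (K : T -> \bar R) : (0 <= d)%R -> (forall x, 0 <= K x) ->
    \esum_(x in I) (d%:E * K x) <= d%:E * \esum_(x in I) K x.
  move=> d0 K0; apply: ge_ereal_sup => _ [X [finX XI]] <-.
  rewrite -ge0_mule_fsumr //; apply: lee_pmul => //.
    by apply: fsume_ge0.
  by apply: ereal_sup_ubound; exists X.
apply/eqP; rewrite eq_le le //=.
have [->|c_neq0] := eqVneq c 0%R.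
  by rewrite mul0e esum_ge0// => x _; rewrite mul0e.
have c_gt0 : (0 < c)%R by rewrite lt_neqAle eq_sym c_neq0.
have cF0 x : 0 <= c%:E * F x by rewrite mule_ge0.
have := le (c^-1)%R (fun x => c%:E * F x).
rewrite invr_ge0 ltW// => /(_ isT cF0).
under eq_esum => x _ do rewrite muleA -EFinM mulVf ?gt_eqF// mul1e.
by rewrite lee_pdivlMl.
Qed.

Lemma esum_swap (T T' : choiceType) (F : T -> T' -> \bar R) :
  (forall x y, 0 <= F x y) ->
  \esum_ x \esum_ y F x y = \esum_ y \esum_ x F x y.
Proof.
move=> F0; rewrite !esum_esum //.
rewrite (@reindex_esum R _ _ (setT `*`` (fun=> setT)) (setT `*`` (fun=> setT))
  (fun z : T' * T => (z.2, z.1)) (fun z => F z.1 z.2)) //.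
split => // [[a b] [c d] _ _ [-> ->] //|[a b] _].
by exists (b, a).
Qed.

Lemma esum_pair (T T' : choiceType) (F : T * T' -> \bar R) :
  (forall z, 0 <= F z) ->
  \esum_ z F z = \esum_ x \esum_ y F (x, y).
Proof.
move=> F0; rewrite esum_esum //.
have -> : setT `*`` (fun=> [set: T']) = [set: T * T'] by apply/seteqP; split.
by apply: eq_esum => -[].
Qed.

Lemma reindex_esumT (T T' : choiceType) (e : T -> T') (e' : T' -> T)
    (F : T' -> \bar R) : cancel e e' -> cancel e' e ->
  \esum_ y F y = \esum_ x F (e x).
Proof.
move=> ee' e'e; apply: reindex_esum; split => //.
- by move=> a b _ _ /(can_inj ee').
- by move=> y _; exists (e' y).
Qed.

Lemma esum_ge1 (T : choiceType) (F : T -> \bar R) x :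
  (forall x, 0 <= F x) -> F x <= \esum_ x F x.
Proof.
move=> F0; apply: esum_ge; exists [set x]; last by rewrite fsbig_set1.
by split => //; exact: finite_set1.
Qed.

Lemma esum_delta (T : choiceType) (t : T) (F : T -> \bar R) :
  0 <= F t -> (forall x, x != t -> F x = 0) -> \esum_ x F x = F t.
Proof.
move=> Ft0 Fx; rewrite -(esum_set1 Ft0) [RHS]esum_mkcond; apply: eq_esum => x _.
by case: ifPn => // /negP; rewrite inE /= => /eqP /Fx.
Qed.

End sums.

Arguments esumZ {R T I c F}.

(** * Convolution powers and harmonic functions *)

Section mass.
Context {R : realType} {T : choiceType}.
Implicit Types p : T -> R.

Definition prob_mass p := (forall x, (0 <= p x)%R) /\ \esum_ x (p x)%:E = 1.

Lemma mass_le1 p x : prob_mass p -> (p x <= 1)%R.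
Proof.
move=> [p0 p1]; rewrite -lee_fin -p1; apply: (@esum_ge1 _ _ (EFin \o p)) => y /=.
by rewrite lee_fin.
Qed.

Definition mean p (f : T -> R) := \esum_ x (p x * f x)%:E.

End mass.

Section means.
Context {R : realType} {T : choiceType}.
Implicit Types (p f : T -> R).

Lemma mean_ge0 p f : prob_mass p -> (forall x, (0 <= f x)%R) -> 0 <= mean p f.
Proof.
by move=> [p0 _] f0; apply: esum_ge0 => x _; rewrite lee_fin mulr_ge0.
Qed.

Lemma mean_le1 p f : prob_mass p -> (forall x, (0 <= f x <= 1)%R) -> mean p f <= 1.
Proof.
move=> [p0 p1] f01; rewrite -p1; apply: le_esum => x _; rewrite lee_fin.
by rewrite ler_piMr //; case/andP: (f01 x).
Qed.

Lemma mean_fin p f : prob_mass p -> (forall x, (0 <= f x <= 1)%R) ->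
  (fine (mean p f))%:E = mean p f.
Proof.
move=> pp f01; rewrite fineK // ge0_fin_numE.
  by apply: le_lt_trans (mean_le1 pp f01) _; exact: ltry.
by apply: mean_ge0 => // x; case/andP: (f01 x).
Qed.

Lemma mean_compl p f : prob_mass p -> (forall x, (0 <= f x <= 1)%R) ->
  mean p f + mean p (fun x => 1 - f x)%R = 1.
Proof.
move=> [p0 p1] f01; rewrite -esumD; first last.
- by move=> x _; rewrite lee_fin mulr_ge0 // subr_ge0; case/andP: (f01 x).
- by move=> x _; rewrite lee_fin mulr_ge0 //; case/andP: (f01 x).
- rewrite -p1; apply: eq_esum => x _; rewrite -EFinD; congr (_%:E); ring.
Qed.

Lemma mean_compl_eq p f (a : R) : prob_mass p -> (forall x, (0 <= f x <= 1)%R) ->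
  (mean p f = a%:E) -> mean p (fun x => 1 - f x)%R = (1 - a)%:E.
Proof.
move=> pp f01 fa; have := mean_compl pp f01; rewrite fa.
have g01 x : (0 <= 1 - f x <= 1)%R by have := f01 x; lra.
rewrite -(mean_fin pp g01).
by rewrite -EFinD => -[e]; congr (_%:E); lra.
Qed.

End means.

Section group.
Context {R : realType} {G : groupType}.
Implicit Types (p : G -> R) (f : G -> R) (g x y : G) (n : nat).

Lemma esum_translate (F : G -> \bar R) g : \esum_ y F y = \esum_ y F (g * y)%g.
Proof.
by apply: (@reindex_esumT _ _ _ _ (fun y => g^-1 * y)%g) => y;
  rewrite ?mulKg ?mulVKg.
Qed.

(** Convolution powers split off the first increment on the left, since the
arguments below condition on that increment. *)
Fixpoint cpow p n : G -> R :=
  match n with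
  | 0 => fun y => (y == 1%g)%:R%R
  | m.+1 => fun y => fine (\esum_ x (p x * cpow p m (x^-1 * y)%g)%:E)
  end.

(** The two facts are proved together: the sum that defines [cpow p n.+1 y] is
finite, so that its [fine] is meaningful, because [cpow p n] is bounded by
1. *)
Lemma cpow_mass_rec p n : prob_mass p -> prob_mass (cpow p n) /\
  forall y, (cpow p n.+1 y)%:E = \esum_ x (p x * cpow p n (x^-1 * y)%g)%:E.
Proof.
move=> [p0 p1].
have step m : prob_mass (cpow p m) ->
    forall y, (cpow p m.+1 y)%:E = \esum_ x (p x * cpow p m (x^-1 * y)%g)%:E.
  move=> pm y /=; rewrite fineK // ge0_fin_numE ?esum_ge0 //; last first.
    by move=> x _; rewrite lee_fin mulr_ge0 // (pm.1).
  apply: (@le_lt_trans _ _ 1); last exact: ltry.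
  rewrite -p1; apply: le_esum => x _; rewrite lee_fin ler_piMr //.
  exact: mass_le1.
suff pm : prob_mass (cpow p n) by split => //; exact: step.
elim: n => [|n IH].
  split => [x /=|]; first by case: eqP.
  rewrite (@esum_delta _ _ 1%g) /= ?eqxx ?lee_fin // => x /negPf /= xe.
  by rewrite xe.
have S := step _ IH.
split => [y|].
  by rewrite -lee_fin S esum_ge0 // => x _; rewrite lee_fin mulr_ge0 // IH.1.
under eq_esum => y _ do rewrite S.
rewrite esum_swap; last by move=> y x; rewrite lee_fin mulr_ge0 // IH.1.
rewrite -p1; apply: eq_esum => x _.
under eq_esum => y _ do rewrite EFinM.
rewrite esumZ //; last by move=> y; rewrite lee_fin IH.1.
rewrite (esum_translate _ x).
under eq_esum => y _ do rewrite mulKg.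
by rewrite IH.2 mule1.
Qed.

Lemma cpow_mass p n : prob_mass p -> prob_mass (cpow p n).
Proof. by move=> pp; case: (cpow_mass_rec n pp). Qed.

Lemma cpow_ge0 p n y : prob_mass p -> (0 <= cpow p n y)%R.
Proof. by move=> /(cpow_mass n) []. Qed.

Lemma cpowS p n y : prob_mass p ->
  (cpow p n.+1 y)%:E = \esum_ x (p x * cpow p n (x^-1 * y)%g)%:E.
Proof. by move=> pp; case: (cpow_mass_rec n pp). Qed.

Lemma cpowS_ge p n x y : prob_mass p ->
  (p x * cpow p n (x^-1 * y)%g <= cpow p n.+1 y)%R.
Proof.
move=> pp; rewrite -lee_fin cpowS //.
apply: (@esum_ge1 _ _ (fun x => (p x * cpow p n (x^-1 * y)%g)%:E)) => z.
by rewrite lee_fin mulr_ge0 ?cpow_ge0 // pp.1.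
Qed.

Lemma mean_cpow0 p f : (forall x, (0 <= f x)%R) -> mean (cpow p 0) f = (f 1%g)%:E.
Proof.
move=> f0; rewrite /mean (@esum_delta _ _ 1%g) /= ?eqxx ?mul1r ?lee_fin //.
by move=> x /negPf ->; rewrite mul0r.
Qed.

Lemma mean_cpowS p f n : prob_mass p -> (forall x, (0 <= f x)%R) ->
  mean (cpow p n.+1) f =
  \esum_ x ((p x)%:E * mean (cpow p n) (fun z => f (x * z)%g)).
Proof.
move=> pp f0; have p0 := pp.1; rewrite /mean.
transitivity (\esum_ y \esum_ x (p x * (cpow p n (x^-1 * y)%g * f y))%:E).
  apply: eq_esum => y _; rewrite EFinM cpowS // muleC -esumZ //; last first.
    by move=> x; rewrite lee_fin mulr_ge0 ?cpow_ge0.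
  by apply: eq_esum => x _; rewrite -EFinM; congr (_%:E); ring.
rewrite esum_swap; last by move=> y x; rewrite lee_fin !mulr_ge0 ?cpow_ge0.
apply: eq_esum => x _; rewrite -esumZ //; last first.
  by move=> z; rewrite lee_fin mulr_ge0 ?cpow_ge0.
rewrite [LHS](esum_translate _ x); apply: eq_esum => z _.
by rewrite mulKg EFinM.
Qed.

Definition harmonic p f := forall g, (f g)%:E = mean p (fun x => f (g * x)%g).

Lemma harmonic_cpow p f n g : prob_mass p -> (forall x, (0 <= f x)%R) ->
  harmonic p f -> (f g)%:E = mean (cpow p n) (fun y => f (g * y)%g).
Proof.
move=> pp f0 hf; elim: n g => [|n IH] g; first by rewrite mean_cpow0 ?mulg1.
rewrite mean_cpowS // hf; apply: eq_esum => x _.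
by rewrite EFinM IH; congr (_ * _); apply: eq_esum => y _; rewrite mulgA.
Qed.

End group.

Arguments cpow : simpl never.

(** * Space-time harmonic functions of lazy walks *)

Section ultralimits.
Context {R : realType}.

Lemma ultra_cvg01 (U : set_system nat) (v : nat -> R) : UltraFilter U ->
  (forall n, (0 <= v n <= 1)%R) ->
  exists2 l : R, v @ U --> l & (0 <= l <= 1)%R.
Proof.
move=> UU v01.
have vU : (v @ U) [set` `[0%R, 1%R]].
  by rewrite /= nbhs_simpl; apply: filterE => n /=; rewrite in_itv /=; exact: v01.
have [l [l01 cl]] := @segment_compact R 0 1 (v @ U) _ vU.
exists l; last by move: l01; rewrite /= in_itv.
move=> B Bl; have [//|UB] := in_ultra_setVsetC (v @^-1` B) UU.
by have [z [/= nB /nB]] := cl (~` B) B UB Bl.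
Qed.

(** Every finite partial sum of the left side is a limit of finite partial sums of
the means of v n. Applied to a family and to its complement to 1, the inequality
gives an equality, which is how a mean is exchanged with a limit along an
ultrafilter below. *)
Lemma fatou_cvg (U : set_system nat) (T : choiceType) (p : T -> R)
    (v : nat -> T -> R) (l : T -> R) (w : nat -> R) (m : R) :
  ProperFilter U -> (forall x, (0 <= p x)%R) -> (forall n x, (0 <= v n x)%R) ->
  (forall x, v n x @[n --> U] --> l x) -> w @ U --> m ->
  (\forall n \near U, mean p (v n) <= (w n)%:E) ->
  mean p l <= m%:E.
Proof.
move=> UF p0 v0 vl wm vw; apply: ge_ereal_sup => _ [X [finX _] <-].
rewrite fsbig_finite //= sumEFin lee_fin.
pose W n := (\sum_(i <- finmap.enum_fset (fset_set X)) p i * v n i)%R.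
apply: (@ler_cvg_to _ _ _ _ W w) wm _.
- apply: cvg_big => [|x _]; first exact: add_continuous.
  by apply: cvgMl_tmp; exact: vl.
- apply: filterS vw => n vw; rewrite -lee_fin; apply: le_trans vw.
  rewrite -sumEFin -(fsbig_finite _ (fun x => (p x * v n x)%:E)) //.
  by apply: ereal_sup_ubound; exists X.
Qed.

End ultralimits.

Section choquet_deny.
Context {R : realType} {G : groupType}.
Variables (p : G -> R).
Hypotheses (pp : prob_mass p) (p_lazy : (0 < p 1%g)%R).

Definition spacetime_harmonic (u : G -> nat -> R) :=
  forall g k, (u g k)%:E = mean p (fun x => u (g * x)%g k.+1).

(** Write u g k.+1 as a mean of the values at time k.+2 and bound each of them by
the value at time k.+1 plus M, except at the atom x = 1, where nothing is lost.
Thus an increment in time that is close to the bound M forces the next one, at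
the same point g, to be close to M as well. *)
Lemma spacetime_drop (u : G -> nat -> R) (M : R) :
  (forall g k, (0 <= u g k <= 1)%R) -> spacetime_harmonic u -> (0 <= M)%R ->
  (forall g k, (u g k.+1 - u g k <= M)%R) ->
  forall g k, (p 1%g * (M - (u g k.+2 - u g k.+1)) <=
               M - (u g k.+1 - u g k))%R.
Proof.
move=> u01 hu M0 uM g k; have [p0 p1] := pp.
have u0 g' k' : (0 <= u g' k')%R by case/andP: (u01 g' k').
pose d := (M - (u g k.+2 - u g k.+1))%R.
have d0 : (0 <= d)%R by rewrite subr_ge0.
suff : (u g k.+1 + p 1%g * d)%:E <= (u g k + M)%:E.
  by rewrite lee_fin /d; lra.
have eM : M%:E = \esum_ x (p x * M)%:E.
  under eq_esum => x _ do rewrite mulrC EFinM.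
  by rewrite esumZ ?p1 ?mule1 // => x; rewrite lee_fin.
have ed : (p 1%g * d)%:E = \esum_ x ((x == 1%g)%:R * (p x * d))%:E.
  rewrite (@esum_delta _ _ 1%g) ?eqxx ?mul1r ?lee_fin ?mulr_ge0 //.
  by move=> x /negPf ->; rewrite mul0r.
rewrite !EFinD !hu ed eM -!esumD; try by
  move=> x _; rewrite lee_fin ?mulr_ge0.
apply: le_esum => x _; rewrite -!EFinD lee_fin.
have [->|_] := eqVneq x 1%g; first by rewrite mulg1 mul1r /d; lra.
rewrite mul0r addr0 -mulrDr; apply: ler_wpM2l => //.
by have := uM (g * x)%g k.+1; lra.
Qed.

(** If the supremum M of the increments in time were positive, a value within
a ^+ J * (M / 2) of it, with a the atom at 1, would be followed at the same
point by J increments of size at least M / 2. For J > 2 / M this contradicts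
the bound on u. *)
Lemma spacetime_nonincreasing (u : G -> nat -> R) :
  (forall g k, (0 <= u g k <= 1)%R) -> spacetime_harmonic u ->
  forall g k, (u g k.+1 <= u g k)%R.
Proof.
move=> u01 hu.
pose E : set R := [set d | exists g k, d = (u g k.+1 - u g k)%R].
have hE : has_sup E.
  split; first by exists (u 1%g 1%N - u 1%g 0%N)%R, 1%g, 0%N.
  by exists 1%R => _ [g [k ->]]; have := u01 g k; have := u01 g k.+1; lra.
pose M := sup E.
have uM g k : (u g k.+1 - u g k <= M)%R.
  by apply: sup_upper_bound => //; exists g, k.
have [M0|M_gt0] := leP M 0%R; first by move=> g k; have := uM g k; lra.
have drop := spacetime_drop u01 hu (ltW M_gt0) uM.
have [J JM] : exists J : nat, (2 < J%:R * M)%R.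
  by exists (Num.bound (2 / M)); rewrite -ltr_pdivrMr // archi_boundP ?divr_ge0 ?ltW.
pose a := p 1%g.
have a1 : (a <= 1)%R by exact: mass_le1.
have eps_gt0 : (0 < a ^+ J * (M / 2))%R.
  by rewrite mulr_gt0 ?exprn_gt0 ?divr_gt0.
have [_ [g [k ->]] close] := sup_adherent eps_gt0 hE.
have iter j : (j <= J)%N ->
    (a ^+ j * (M - (u g (k + j).+1 - u g (k + j)%N)) <= a ^+ J * (M / 2))%R.
  elim: j => [|j IH] jJ; first by rewrite addn0 mul1r -/M in close *; lra.
  rewrite addnS exprSr -mulrA; apply: le_trans (IH (ltnW jJ)).
  by apply: ler_wpM2l => //; rewrite exprn_ge0 // ltW.
have half j : (j <= J)%N -> (M / 2 <= u g (k + j).+1 - u g (k + j)%N)%R.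
  move=> jJ; have := le_trans (iter j jJ) _ => /(_ (a ^+ j * (M / 2))%R).
  rewrite ler_pM2l ?exprn_gt0 //.
  have -> : (a ^+ J * (M / 2) <= a ^+ j * (M / 2))%R.
    apply: ler_wpM2r; first by lra.
    by apply: ler_wiXn2l => //; rewrite ltW.
  by move=> /(_ isT); lra.
have climb j : (j <= J)%N -> (j%:R * (M / 2) <= u g (k + j)%N - u g k)%R.
  elim: j => [|j IH] jJ; first by rewrite addn0 mul0r subrr.
  have := IH (ltnW jJ); have := half j (ltnW jJ).
  by rewrite addnS -[j.+1%:R%R]natr1 mulrDl mul1r; lra.
have := climb J (leqnn J); have := u01 g k; have := u01 g (k + J)%N.
by lra.
Qed.

Lemma choquet_deny (u : G -> nat -> R) :
  (forall g k, (0 <= u g k <= 1)%R) -> spacetime_harmonic u ->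
  forall g k, u g k.+1 = u g k.
Proof.
move=> u01 hu g k; apply/eqP; rewrite eq_le spacetime_nonincreasing //=.
rewrite -(lerD2l 1%R) -(lerN2) -subr_ge0.
have := @spacetime_nonincreasing (fun g k => 1 - u g k)%R.
move=> /(_ _ _ g k) h.
suff : (1 - u g k.+1 <= 1 - u g k)%R by lra.
apply: h => [{}g {}k|{}g {}k]; first by have := u01 g k; lra.
by rewrite (mean_compl_eq pp (a := u g k)).
Qed.

End choquet_deny.

(** * Distance between conditional and unconditional laws *)

Section drift.
Context {R : realType} {G : groupType}.
Implicit Types (p : G -> R) (f : G -> R) (x y g : G) (n : nat).

(** The laws compared are those of the position at time n.+1, given that the
first increment is x, and without this condition. The positive part makes this
half of the l1 distance, see [esum_dist_drift]. *)
Definition drift p n x : \bar R :=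
  \esum_ y (Num.max (cpow p n (x^-1 * y)%g - cpow p n.+1 y) 0)%:E.

Lemma mean_translate p f x :
  mean p (fun z => f (x * z)%g) = mean (fun y => p (x^-1 * y)%g) f.
Proof.
rewrite /mean [RHS](esum_translate _ x); apply: eq_esum => z _.
by rewrite mulKg.
Qed.

Lemma le_mean_drift p n x f : prob_mass p -> (forall g, (0 <= f g <= 1)%R) ->
  mean (cpow p n) (fun z => f (x * z)%g) <=
  mean (cpow p n.+1) f + drift p n x.
Proof.
move=> pp f01; rewrite mean_translate -esumD.
- apply: le_esum => y _; rewrite -EFinD lee_fin.
  have /andP[f0 f1] := f01 y.
  set a := cpow _ _ _; set b := cpow _ _ _.
  have ab : (a - b <= Num.max (a - b) 0)%R by rewrite le_max lexx.
  have max0 : (0 <= Num.max (a - b) 0)%R by rewrite le_max lexx orbT.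
  suff : ((a - b) * f y <= Num.max (a - b) 0)%R by lra.
  by apply: (le_trans (ler_wpM2r f0 ab)); rewrite ler_piMr.
- by move=> y _; rewrite lee_fin mulr_ge0 ?cpow_ge0 //; case/andP: (f01 y).
- by move=> y _; rewrite lee_fin le_max lexx orbT.
Qed.

(** The indicator of the set where the first law exceeds the second attains the
distance. *)
Lemma drift_mean p n x : prob_mass p ->
  exists2 f : G -> R, (forall g, (0 <= f g <= 1)%R) &
  mean (cpow p n) (fun z => f (x * z)%g) =
  mean (cpow p n.+1) f + drift p n x.
Proof.
move=> pp.
pose f y : R := (cpow p n.+1 y < cpow p n (x^-1 * y)%g)%R%:R%R.
exists f.
  by move=> g; rewrite /f; case: (_ < _)%R; rewrite lexx ler01.
rewrite mean_translate -esumD.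
- apply: eq_esum => y _; rewrite -EFinD; congr (_%:E).
  by rewrite /f; case: ltP => h; rewrite ?mulr1 ?mulr0; [rewrite max_l|rewrite max_r]; lra.
- by move=> y _; rewrite lee_fin mulr_ge0 ?cpow_ge0.
- by move=> y _; rewrite lee_fin le_max lexx orbT.
Qed.

(** Compactness. If the drift exceeds e along times t_N tending to infinity,
choose test functions phi_N that attain it and let v_N g k be the mean of phi_N
after t_N + 1 - k steps from g: a function harmonic in space-time up to time
t_N, for which v_N x 1 - v_N 1 0 is at least e. A limit along an ultrafilter is
space-time harmonic for all times, does not depend on time by [choquet_deny],
and is therefore a harmonic function that takes different values at x and
1. *)
Lemma drift_cvg0 p x : prob_mass p -> (0 < p 1%g)%R ->
  (forall f, (forall g, (0 <= f g <= 1)%R) -> harmonic p f -> f x = f 1%g) ->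
  forall e : R, (0 < e)%R ->
  exists N, forall n, (N <= n)%N -> drift p n x <= e%:E.
Proof.
move=> pp p_lazy triv e e0; apply: contrapT => not_cvg.
have far N : exists n, (N <= n)%N /\ e%:E < drift p n x.
  apply: contrapT => h; apply: not_cvg; exists N => n Nn.
  by rewrite leNgt; apply/negP => ?; apply: h; exists n.
have [t /all_and2[t_ge t_far]] := choice far.
have /choice[phi /all_and2[phi01 phi_drift]] :
    forall N, exists f : G -> R, (forall g, (0 <= f g <= 1)%R) /\
    mean (cpow p (t N)) (fun z => f (x * z)%g) =
    mean (cpow p (t N).+1) f + drift p (t N) x.
  by move=> N; have [f] := drift_mean (t N) x pp; exists f.
pose v N g k :=
  fine (mean (cpow p ((t N).+1 - k)) (fun y => phi N (g * y)%g)).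
have vE N g k : (v N g k)%:E =
    mean (cpow p ((t N).+1 - k)) (fun y => phi N (g * y)%g).
  by rewrite /v mean_fin //; exact: cpow_mass.
have v01 N g k : (0 <= v N g k <= 1)%R.
  rewrite -!lee_fin vE mean_ge0 ?mean_le1 //; try exact: cpow_mass.
  by move=> y; case/andP: (phi01 N (g * y)%g).
have v_st N g k : (k <= t N)%N ->
    (v N g k)%:E = mean p (fun y => v N (g * y)%g k.+1).
  move=> kN; rewrite vE subSn // mean_cpowS //; last first.
    by move=> y; case/andP: (phi01 N (g * y)%g).
  rewrite /mean; apply: eq_esum => y _; rewrite EFinM vE; congr (_ * _).
  by apply: eq_esum => z _; rewrite mulgA.
have [U [UU oU]] := ultraFilterLemma eventually_filter.
have UP : ProperFilter U := @ultra_proper _ U UU.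
have /choice[u' u'P] : forall gk : G * nat, exists l : R,
    ((fun N => v N gk.1 gk.2) @ U --> l) /\ (0 <= l <= 1)%R.
  move=> [g k].
  have [l ? ?] := ultra_cvg01 (v := fun N => v N g k) UU (fun N => v01 N g k).
  by exists l.
pose u g k := u' (g, k).
have vu g k : (fun N => v N g k) @ U --> u g k by case: (u'P (g, k)).
have u01 g k : (0 <= u g k <= 1)%R by case: (u'P (g, k)).
have u_ge g k : mean p (fun y => u (g * y)%g k.+1) <= (u g k)%:E.
  apply: (fatou_cvg UP pp.1 (v := fun N y => v N (g * y)%g k.+1)
    (w := fun N => v N g k)) => //.
    by move=> N y; case/andP: (v01 N (g * y)%g k.+1).
  apply: oU; exists k => // N /= kN.
  by rewrite v_st // (leq_trans kN).
have u_le g k : mean p (fun y => 1 - u (g * y)%g k.+1)%R <= (1 - u g k)%:E.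
  apply: (fatou_cvg UP pp.1 (v := fun N y => (1 - v N (g * y)%g k.+1)%R)
    (w := fun N => (1 - v N g k)%R)) => //.
  - by move=> N y; have := v01 N (g * y)%g k.+1; lra.
  - by move=> y; apply: cvgB => //; exact: cvg_cst.
  - by apply: cvgB => //; exact: cvg_cst.
  - apply: oU; exists k => // N /= kN.
    by rewrite (mean_compl_eq (a := v N g k)) // v_st // (leq_trans kN).
have u_st : spacetime_harmonic p u.
  move=> g k; have U01 y : (0 <= u (g * y)%g k.+1 <= 1)%R by [].
  have := u_ge g k; have := u_le g k; rewrite -(mean_fin pp U01).
  rewrite (mean_compl_eq pp U01 (esym (mean_fin pp U01))) !lee_fin => ? ?.
  by congr (_%:E); lra.
have := choquet_deny pp p_lazy u01 u_st => u_const.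
have harm : harmonic p (fun g => u g 0%N).
  by move=> g; rewrite u_st; apply: eq_esum => y _; rewrite u_const.
have := triv _ (fun g => u01 g 0%N) harm.
suff : (u 1%g 0%N + e <= u x 1%N)%R by rewrite u_const; lra.
have gap N : (v N 1%g 0%N + e <= v N x 1%N)%R.
  rewrite -lee_fin EFinD !vE subn0 subSS subn0.
  rewrite phi_drift; apply: leeD; last exact: ltW.
  by apply: le_esum => z _; rewrite mul1g.
have lim_l : (fun N => v N 1%g 0%N + e)%R @ U --> (u 1%g 0%N + e)%R.
  by apply: cvgD; [exact: vu|exact: cvg_cst].
by apply: (ler_cvg_to lim_l (vu x 1%N)); apply: filterE; exact: gap.
Qed.

End drift.

(** * Relative entropy *)

Section kullback_leibler.
Context {R : realType}.
Local Open Scope ring_scope.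
Implicit Types a b c d : R.

(** The terms - a + b cancel when one sums over two probability vectors; with
them the integrand of the relative entropy is nonnegative. *)
Definition kl a b : R := a * ln a - a * ln b - a + b.

Lemma ln_le_sub1 a : 0 < a -> ln a <= a - 1.
Proof. by move=> a0; have := expR_ge1Dx (ln a); rewrite lnK ?posrE //; lra. Qed.

(** With s and t the square roots of a and b, use ln (t / s) <= t / s - 1. *)
Lemma kl_ge_hellinger a b : 0 <= a -> 0 <= b -> (b = 0 -> a = 0) ->
  (Num.sqrt a - Num.sqrt b) ^+ 2 <= kl a b.
Proof.
move=> a0 b0 ab; rewrite /kl.
have [a_eq0|a_neq0] := eqVneq a 0.
  by rewrite a_eq0 sqrtr0 sub0r sqrrN sqr_sqrtr // !mul0r; lra.
have b_neq0 : b != 0 by apply: contra a_neq0 => /eqP /ab /eqP.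
have s0 : 0 < Num.sqrt a by rewrite sqrtr_gt0 lt_neqAle eq_sym a_neq0.
have t0 : 0 < Num.sqrt b by rewrite sqrtr_gt0 lt_neqAle eq_sym b_neq0.
rewrite -{2 3 4 5}(sqr_sqrtr a0) -{2 3}(sqr_sqrtr b0).
move: (Num.sqrt a) (Num.sqrt b) s0 t0 => s t s0 t0.
rewrite !lnXn // !mulr2n.
have := ln_le_sub1 (divr_gt0 t0 s0); rewrite ln_div ?posrE // => h.
have : s ^+ 2 * (ln t - ln s) <= s * t - s ^+ 2.
  apply: le_trans (ler_wpM2l (sqr_ge0 s) h) _.
  by rewrite mulrBr mulr1 expr2 -mulrA [s * (t / s)]mulrC divfK ?gt_eqF.
by lra.
Qed.

Lemma kl_ge0 a b : 0 <= a -> 0 <= b -> (b = 0 -> a = 0) -> 0 <= kl a b.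
Proof.
by move=> a0 b0 ab; apply: le_trans (kl_ge_hellinger a0 b0 ab); exact: sqr_ge0.
Qed.

(** With X and Y the difference and the sum of the square roots of a and b,
a - b = X * Y <= (X ^ 2 / d + d * Y ^ 2) / 2, and [kl_ge_hellinger] bounds
X ^ 2. The parameter d stands for an application of the Cauchy-Schwarz
inequality to the sums, and keeps the inequality termwise. *)
Lemma pinsker a b d : 0 <= a -> 0 <= b -> (b = 0 -> a = 0) -> 0 < d ->
  a - b <= d^-1 * kl a b + d * (a + b).
Proof.
move=> a0 b0 ab d0; have d'0 : 0 < d^-1 by rewrite invr_gt0.
have dd : d^-1 * d = 1 by rewrite mulVf // gt_eqF.
have := ler_wpM2l (ltW d'0) (kl_ge_hellinger a0 b0 ab).
move: (kl a b) => K; rewrite -{2 3}(sqr_sqrtr a0) -{2 3}(sqr_sqrtr b0).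
move: (Num.sqrt a) (Num.sqrt b) => s t h.
have h1 := mulr_ge0 (ltW d'0) (sqr_ge0 ((s - t) - d * (s + t))).
have e1 : d^-1 * ((s - t) - d * (s + t)) ^+ 2 =
    d^-1 * (s - t) ^+ 2 - 2 * (s ^+ 2 - t ^+ 2) + d * (s + t) ^+ 2.
  have -> : d * (s + t) ^+ 2 = (d^-1 * d) * (d * (s + t) ^+ 2) by rewrite dd mul1r.
  have -> : 2 * (s ^+ 2 - t ^+ 2) = (d^-1 * d) * (2 * (s ^+ 2 - t ^+ 2)).
    by rewrite dd mul1r.
  by ring.
have h2 := mulr_ge0 (ltW d0) (sqr_ge0 (s - t)).
have h3 := mulr_ge0 (ltW d'0) (sqr_ge0 (s - t)).
by rewrite e1 in h1; lra.
Qed.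

(** By ln r <= r - 1 at r = a / b the left side is at most b (r - 1) ^ 2, and
the distance of r to 1 is at most c. *)
Lemma kl_le_dist a b c : 0 <= a -> 0 <= b -> 1 <= c -> a <= c * b ->
  kl a b <= c * `|a - b|.
Proof.
move=> a0 b0 c1 ab; rewrite /kl.
have [a_eq0|a_neq0] := eqVneq a 0.
  rewrite a_eq0 !mul0r distrC [b - 0]subr0 ger0_norm //.
  by have := ler_peMl b0 c1; lra.
have a_gt0 : 0 < a by rewrite lt_neqAle eq_sym a_neq0.
have b_gt0 : 0 < b.
  rewrite lt_neqAle b0 andbT; apply/eqP => b_eq0.
  by move: ab a_gt0; rewrite -b_eq0 mulr0; lra.
pose r := a / b.
have ar : a = r * b by rewrite /r divfK // gt_eqF.
have r0 : 0 < r by rewrite divr_gt0.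
have rc : r <= c by rewrite ler_pdivrMr.
have := ln_le_sub1 r0; rewrite {1}/r ln_div ?posrE // => h.
clearbody r.
have h1 : a * ln a - a * ln b - a + b <= b * ((r - 1) * (r - 1)).
  have -> : b * ((r - 1) * (r - 1)) = a * (r - 1) - a + b by rewrite ar; ring.
  by have := ler_wpM2l (ltW a_gt0) h; lra.
apply: le_trans h1 _.
have -> : `|a - b| = b * `|r - 1|.
  rewrite ar (_ : r * b - b = b * (r - 1)); last by ring.
  by rewrite normrM ger0_norm.
rewrite [leRHS]mulrCA; apply: ler_wpM2l => //.
have h2 : (r - 1) * (r - 1) <= `|r - 1| * `|r - 1| by rewrite -normrM ler_norm.
apply: le_trans h2 _; apply: ler_wpM2r => //.
by rewrite ler_norml; lra.
Qed.

Lemma kl_le_log a b c : 0 <= a -> 0 < c -> c * a <= b ->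
  kl a b <= - (a * ln c) - a + b.
Proof.
move=> a0 c0 cab; rewrite /kl.
have [->|a_neq0] := eqVneq a 0; first by rewrite !mul0r; lra.
have a_gt0 : 0 < a by rewrite lt_neqAle eq_sym a_neq0.
have ca0 : 0 < c * a by rewrite mulr_gt0.
have : ln (c * a) <= ln b by rewrite ler_ln ?posrE // (lt_le_trans ca0).
rewrite lnM ?posrE // => h.
by have := ler_wpM2l a0 h; rewrite mulrDr; lra.
Qed.

End kullback_leibler.

Section dominated.
Context {R : realType} {T : choiceType}.

Lemma esum_dominated_cvg0 (F : nat -> T -> \bar R) (B : T -> R) :
  (forall n x, 0 <= F n x <= (B x)%:E) -> \esum_ x (B x)%:E < +oo ->
  (forall x (e : R), (0 < e)%R -> \forall n \near \oo, F n x <= e%:E) ->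
  forall e : R, (0 < e)%R -> \forall n \near \oo, \esum_ x F n x <= e%:E.
Proof.
move=> FB Bfin F0 e e0.
have B0 x : 0 <= (B x)%:E by case/andP: (FB 0%N x); exact: le_trans.
have sum0 (s : seq T) (d : R) : (0 < d)%R ->
    \forall n \near \oo, \sum_(x <- s) F n x <= d%:E.
  elim: s d => [|x s IH] d d0.
    by apply: nearW => n; rewrite big_nil lee_fin ltW.
  have d20 : (0 < d / 2)%R by rewrite divr_gt0.
  near=> n; rewrite big_cons [d]splitr EFinD; apply: leeD.
    by near: n; exact: F0.
  by near: n; exact: IH.
have Bnum : \esum_ x (B x)%:E \is a fin_num.
  by rewrite ge0_fin_numE ?esum_ge0.
have e20 : (0 < e / 2)%R by rewrite divr_gt0.
have [_ [X [finX _] <-] XB] := ub_ereal_sup_adherent e20 Bnum.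
have tail : \esum_(x in ~` X) (B x)%:E <= (e / 2)%:E.
  move: XB Bnum.
  rewrite -/(esum _ _) (esumID X) // !setTI esum_fset //.
  set S := \sum_(x \in X) _; set Tl := \esum_(x in ~` X) _ => XB Bnum.
  have [Sf Tf] : S \is a fin_num /\ Tl \is a fin_num.
    by move: Bnum; rewrite fin_numD => /andP.
  move: XB; rewrite -(fineK Sf) -(fineK Tf) /= lte_fin lee_fin.
  by lra.
near=> n.
rewrite (esumID X) ?setTI; last by move=> x _; case/andP: (FB n x).
rewrite esum_fset //; last by move=> x _; case/andP: (FB n x).
rewrite fsbig_finite // [e]splitr EFinD; apply: leeD.
  by near: n; exact: sum0.
apply: le_trans tail; apply: le_esum => x _.
by case/andP: (FB n x).
Unshelve. all: by end_near. Qed.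

End dominated.

(** * Entropy of convolution powers *)

Section entropy_of_powers.
Context {R : realType}.

Definition ent (T : choiceType) (p : T -> R) : \bar R :=
  \esum_ x (- (p x * ln (p x)))%:E.

Lemma entropy_term_ge0 (a : R) : (0 <= a <= 1)%R -> (0 <= - (a * ln a))%R.
Proof. by case/andP=> a0 a1; rewrite oppr_ge0 mulr_ge0_le0 // ln_le0. Qed.

Lemma mass01 (T : choiceType) (p : T -> R) x : prob_mass p -> (0 <= p x <= 1)%R.
Proof. by move=> pp; rewrite pp.1 mass_le1. Qed.

Lemma ent_ge0 (T : choiceType) (p : T -> R) : prob_mass p -> 0 <= ent p.
Proof.
by move=> pp; apply: esum_ge0 => x _; rewrite lee_fin entropy_term_ge0 // mass01.
Qed.

Context {G : groupType}.
Variable p : G -> R.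
Hypothesis pp : prob_mass p.
Implicit Types (x y : G) (n : nat).

Let p0 x : (0 <= p x)%R. Proof. exact: pp.1. Qed.
Let c0 n y : (0 <= cpow p n y)%R. Proof. exact: cpow_ge0. Qed.
Let c01 n y : (0 <= cpow p n y <= 1)%R. Proof. exact/mass01/cpow_mass. Qed.

(** These are p x times the relative entropies of the two laws of which [drift]
is the distance. Their sum over x is the mutual information between the first
increment and the position at time n.+1. With the weight p x the summands
are nonnegative even for x outside the support of p, where the law in the second
argument of [kl] may vanish on the support of the first. *)
Definition info n x : \bar R :=
  \esum_ y (p x * kl (cpow p n (x^-1 * y)%g) (cpow p n.+1 y))%:E.

Lemma kl_weighted_ge0 n x y :
  (0 <= p x * kl (cpow p n (x^-1 * y)%g) (cpow p n.+1 y))%R.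
Proof.
have [->|px] := eqVneq (p x) 0%R; first by rewrite mul0r.
have px0 : (0 < p x)%R by rewrite lt_neqAle eq_sym px p0.
apply: mulr_ge0 => //; apply: kl_ge0 => // b0.
have := cpowS_ge n x y pp; rewrite b0 => h; apply/eqP.
by rewrite eq_le c0 andbT -(ler_pM2l px0) mulr0.
Qed.

Lemma info_ge0 n x : 0 <= info n x.
Proof. by apply: esum_ge0 => y _; rewrite lee_fin kl_weighted_ge0. Qed.

Lemma cpow_translate_mass n x : \esum_ y (cpow p n (x^-1 * y)%g)%:E = 1.
Proof.
rewrite -(cpow_mass n pp).2 [RHS](esum_translate _ x^-1%g).
by apply: eq_esum.
Qed.

Lemma esum_weighted_translate n x : \esum_ y (p x * cpow p n (x^-1 * y)%g)%:E = (p x)%:E.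
Proof.
under eq_esum => y _ do rewrite EFinM.
by rewrite esumZ ?cpow_translate_mass ?mule1 // => y; rewrite lee_fin.
Qed.

Lemma esum_weighted n x : \esum_ y (p x * cpow p n y)%:E = (p x)%:E.
Proof.
under eq_esum => y _ do rewrite EFinM.
by rewrite esumZ ?(cpow_mass n pp).2 ?mule1 // => y; rewrite lee_fin.
Qed.

(** The chain rule. Given the first increment, the position at time n.+1 has the
entropy of [cpow p n], by translation invariance. Adding the relative entropy
with respect to the unconditional law b gives the mean of - ln b under the
conditional law, and the average of that over the first increment is the entropy
of b. Both sides are increased by a total mass 1 to keep all series
nonnegative. *)
Lemma ent_cpowS n : ent (cpow p n) \is a fin_num ->
  ent (cpow p n.+1) = ent (cpow p n) + \esum_ x info n x.
Proof.
move=> fin.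
pose a x y := cpow p n (x^-1 * y)%g; pose b y := cpow p n.+1 y.
have a01 x y : (0 <= a x y <= 1)%R by exact: c01.
have a0 x y : (0 <= a x y)%R by exact: c0.
have b01 y : (0 <= b y <= 1)%R by exact: c01.
have lnb y : (0 <= - ln (b y))%R.
  by rewrite oppr_ge0 ln_le0 //; case/andP: (b01 y).
have A : ent (cpow p n) = \esum_ x \esum_ y (p x * - (a x y * ln (a x y)))%:E.
  transitivity (\esum_ x ((p x)%:E * ent (cpow p n))).
    rewrite -(fineK fin).
    under eq_esum => x _ do rewrite muleC.
    by rewrite esumZ ?pp.2 ?mule1 ?fine_ge0 ?ent_ge0 //; exact: cpow_mass.
  apply: eq_esum => x _; rewrite /ent -esumZ //; last first.
    by move=> y; rewrite lee_fin entropy_term_ge0.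
  rewrite (esum_translate _ x^-1%g); apply: eq_esum => y _.
  by rewrite -EFinM.
have C : ent b = \esum_ x \esum_ y (p x * a x y * - ln (b y))%:E.
  rewrite esum_swap; last by move=> x y; rewrite lee_fin !mulr_ge0.
  apply: eq_esum => y _; rewrite -mulrN EFinM {1}/b cpowS // muleC.
  rewrite -esumZ //; last by move=> x; rewrite lee_fin mulr_ge0.
  by apply: eq_esum => x _; rewrite -EFinM; congr (_%:E); rewrite mulrC.
have S1 : \esum_ x \esum_ y (p x * a x y)%:E = 1.
  by rewrite -pp.2; apply: eq_esum => x _; rewrite esum_weighted_translate.
have S2 : \esum_ x \esum_ y (p x * b y)%:E = 1.
  by rewrite -pp.2; apply: eq_esum => x _; rewrite esum_weighted.
have n1 x y : 0 <= (p x * - (a x y * ln (a x y)))%:E.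
  by rewrite lee_fin mulr_ge0 ?entropy_term_ge0.
have n2 x y : 0 <= (p x * kl (a x y) (b y))%:E by rewrite lee_fin kl_weighted_ge0.
have n3 x y : 0 <= (p x * a x y)%:E by rewrite lee_fin mulr_ge0.
have n4 x y : 0 <= (p x * a x y * - ln (b y))%:E by rewrite lee_fin !mulr_ge0.
have n5 x y : 0 <= (p x * b y)%:E by rewrite lee_fin mulr_ge0 ?c0.
have B : \esum_ x info n x = \esum_ x \esum_ y (p x * kl (a x y) (b y))%:E by [].
have nn := (n1, n2, n3, n4, n5).
have key : ent b + 1 = ent (cpow p n) + \esum_ x info n x + 1.
  rewrite C A B -{1}S2 -{1}S1 -!esumD; try by
    move=> x _; do ?apply: adde_ge0; apply: esum_ge0 => y _; rewrite nn.
  apply: eq_esum => x _; rewrite -!esumD; try by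
    move=> y _; rewrite ?adde_ge0 ?nn.
  by apply: eq_esum => y _; rewrite -!EFinD /kl; congr (_%:E); ring.
by move: key; rewrite -/b => /(congr1 (fun z => z - 1)); rewrite !addeK.
Qed.
End entropy_of_powers.

Section entropy_growth.
Context {R : realType} {G : groupType}.
Variable p : G -> R.
Hypothesis pp : prob_mass p.
Implicit Types (x y : G) (n : nat).

Let p0 x : (0 <= p x)%R. Proof. exact: pp.1. Qed.
Let c0 n y : (0 <= cpow p n y)%R. Proof. exact: cpow_ge0. Qed.
Let c01 n y : (0 <= cpow p n y <= 1)%R. Proof. exact/mass01/cpow_mass. Qed.

Lemma info_null n x : p x = 0%R -> info p n x = 0.
Proof. by move=> px; apply: esum1 => y _; rewrite px mul0r. Qed.

(** The mass p x of an increment bounds the density of the conditional law by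
(p x)^-1, so the relative entropy is at most - ln (p x). *)
Lemma info_le_ent n x : info p n x <= (- (p x * ln (p x)))%:E.
Proof.
have [px|px] := eqVneq (p x) 0%R; first by rewrite info_null // px mul0r oppr0.
have px0 : (0 < p x)%R by rewrite lt_neqAle eq_sym px p0.
have lnp : (0 <= - ln (p x))%R by rewrite oppr_ge0 ln_le0 // mass_le1.
rewrite -(@leeD2rE _ (p x)%:E) // -{1}(esum_weighted_translate pp n x) -(esum_weighted pp n.+1 x).
have -> : (- (p x * ln (p x)))%:E =
    \esum_ y (p x * cpow p n (x^-1 * y)%g * - ln (p x))%:E.
  under eq_esum => y _ do rewrite mulrC EFinM.
  rewrite esumZ ?esum_weighted_translate // -?EFinM.
    by congr (_%:E); ring.
  by move=> y; rewrite lee_fin mulr_ge0.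
rewrite -!esumD; try by move=> y _; rewrite lee_fin ?kl_weighted_ge0 ?mulr_ge0.
apply: le_esum => y _; rewrite -!EFinD lee_fin.
have h := kl_le_log (c0 n (x^-1 * y)%g) px0 (cpowS_ge n x y pp).
by have := ler_wpM2l (ltW px0) h; lra.
Qed.

(** Both vectors have mass one, so the positive and negative parts of their
difference have the same sum. *)
Lemma esum_dist_drift n x :
  \esum_ y `|cpow p n (x^-1 * y)%g - cpow p n.+1 y|%:E = 2%:E * drift p n x.
Proof.
have max0 (a b : R) : 0 <= (Num.max (a - b) 0)%:E.
  by rewrite lee_fin le_max lexx orbT.
suff : \esum_ y `|cpow p n (x^-1 * y)%g - cpow p n.+1 y|%:E + 1 =
    2%:E * drift p n x + 1.
  by move=> /(congr1 (fun z => z - 1)); rewrite !addeK.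
rewrite -{1}(cpow_translate_mass pp n x) -[in RHS](cpow_mass n.+1 pp).2 -esumZ //.
rewrite -!esumD; try by move=> y _; rewrite ?mule_ge0 // lee_fin.
apply: eq_esum => y _; rewrite -EFinM -!EFinD; congr (_%:E).
set a := cpow p n _; set b := cpow p n.+1 y.
have [ba|ab] := boolP (b <= a)%R.
  by rewrite max_l ?ger0_norm ?subr_ge0 //; lra.
rewrite -ltNge in ab.
by rewrite max_r ?ler0_norm ?subr_le0 ?ltW //; lra.
Qed.

Lemma info_le_drift n x : (0 < p x)%R -> info p n x <= 2%:E * drift p n x.
Proof.
move=> px0; rewrite -esum_dist_drift; apply: le_esum => y _; rewrite lee_fin.
have pV : (1 <= (p x)^-1)%R by rewrite invf_ge1 // mass_le1.
have := kl_le_dist (c0 n (x^-1 * y)%g) (c0 n.+1 y) pV.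
rewrite ler_pdivlMl // => /(_ (cpowS_ge n x y pp)) h.
by rewrite -ler_pdivlMl.
Qed.

Lemma drift_le_info n x (d : R) : (0 < p x)%R -> (0 < d)%R ->
  drift p n x <= (d * p x)^-1%:E * info p n x + (2 * d)%:E.
Proof.
move=> px0 d0.
have -> : (2 * d)%:E = \esum_ y (d * cpow p n (x^-1 * y)%g)%:E +
                       \esum_ y (d * cpow p n.+1 y)%:E.
  under eq_esum => y _ do rewrite EFinM.
  under [X in _ = _ + X]eq_esum => y _ do rewrite EFinM.
  rewrite !esumZ ?cpow_translate_mass ?(cpow_mass n.+1 pp).2 ?ltW //; try by
    move=> y; rewrite lee_fin.
  by rewrite !mule1 -EFinD mulr2n mulrDl mul1r.
have dp : (0 <= (d * p x)^-1)%R by rewrite invr_ge0 mulr_ge0 // ltW.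
have d0' := ltW d0.
rewrite -(esumZ dp); last by move=> y; rewrite lee_fin kl_weighted_ge0.
rewrite -!esumD; try by
  move=> y _; rewrite ?adde_ge0 // -?EFinM lee_fin mulr_ge0 ?kl_weighted_ge0.
apply: le_esum => y _; rewrite -!EFinM -!EFinD lee_fin.
rewrite invfM -mulrA mulKf ?gt_eqF //.
have kl0 : cpow p n.+1 y = 0%R -> cpow p n (x^-1 * y)%g = 0%R.
  move=> b0; have := cpowS_ge n x y pp; rewrite b0 => h; apply/eqP.
  by rewrite eq_le c0 andbT -(ler_pM2l px0) mulr0.
have h := pinsker (c0 n (x^-1 * y)%g) (c0 n.+1 y) kl0 d0.
have k0 := mulr_ge0 (ltW px0) (kl_weighted_ge0 pp n x y).
rewrite ge_max -mulrDr h andTb.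
have K0 := kl_ge0 (c0 n (x^-1 * y)%g) (c0 n.+1 y) kl0.
by rewrite addr_ge0 // mulr_ge0 ?invr_ge0 // addr_ge0.
Qed.

Hypothesis pfin : ent p < +oo.

Lemma ent_cpow_fin n : ent (cpow p n) \is a fin_num.
Proof.
elim: n => [|n IH].
  suff -> : ent (cpow p 0) = 0 by [].
  by apply: esum1 => y _; rewrite /cpow; case: eqP; rewrite ?ln1 ?mulr0 ?mul0r oppr0.
rewrite ge0_fin_numE ?ent_ge0 //; last exact: cpow_mass.
rewrite ent_cpowS //; apply: lte_add_pinfty; first by rewrite ltey_eq IH.
by apply: le_lt_trans pfin; apply: le_esum => x _; exact: info_le_ent.
Qed.

(** By the chain rule it suffices that the mutual informations tend to 0. Each
summand does by [info_le_drift], and the entropy of p dominates the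
sum. *)
Lemma ent_sublinear :
  (forall x, (0 < p x)%R -> forall e : R, (0 < e)%R ->
     exists N, forall n, (N <= n)%N -> drift p n x <= e%:E) ->
  forall e : R, (0 < e)%R -> exists N (C : R), forall n,
    ent (cpow p (N + n)) <= (C + e * n%:R)%:E.
Proof.
move=> drift0 e e0.
have [N _ NP] : \forall n \near \oo, \esum_ x info p n x <= e%:E.
  apply: (esum_dominated_cvg0 (B := fun x => - (p x * ln (p x)))%R) => //.
    by move=> n x; rewrite info_ge0 // info_le_ent.
  move=> x d d0.
  have [px|px] := eqVneq (p x) 0%R.
    by apply: nearW => n; rewrite info_null // lee_fin ltW.
  have px0 : (0 < p x)%R by rewrite lt_neqAle eq_sym px p0.
  have [|M MP] := drift0 x px0 (d / 2)%R; first by rewrite divr_gt0.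
  exists M => // n /= Mn; apply: le_trans (info_le_drift n px0) _.
  rewrite -[leRHS](_ : 2%:E * (d / 2)%:E = _).
    by rewrite lee_pmul2l // MP.
  by rewrite -EFinM mulrC divfK.
exists N, (fine (ent (cpow p N))); elim=> [|n IH].
  by rewrite addn0 mulr0 addr0 fineK // ent_cpow_fin.
rewrite addnS ent_cpowS ?ent_cpow_fin // -[n.+1%:R%R]natr1 mulrDr mulr1 addrA.
rewrite EFinD; apply: leeD => //; apply: NP => /=.
by rewrite leq_addr.
Qed.

Lemma info_ent_le (d : R) x n : (forall k, d%:E <= info p k x) ->
  (n%:R * d)%:E <= ent (cpow p n).
Proof.
move=> dinfo; elim: n => [|n IH].
  by rewrite mul0r ent_ge0 //; exact: cpow_mass.
rewrite ent_cpowS ?ent_cpow_fin // -natr1 mulrDl mul1r EFinD leeD //.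
by apply: le_trans (dinfo n) _; apply: esum_ge1 => y; exact: info_ge0.
Qed.

End entropy_growth.

(** * Images of probability vectors and subadditivity *)

Section images.
Context {R : realType}.

(** In terms of means of indicators, so that the computation of sums over fibres
reduces to an exchange of two summations. *)
Definition is_image (T T' : choiceType) (pi : T -> T') (p : T -> R) (q : T' -> R) :=
  forall t, (q t)%:E = mean p (fun x => (pi x == t)%:R%R).

Section choice_types.
Context {T T' : choiceType} (pi : T -> T') (p : T -> R) (q : T' -> R).
Hypotheses (pp : prob_mass p) (im : is_image pi p q).

Lemma image_ge0 t : (0 <= q t)%R.
Proof. by rewrite -lee_fin im mean_ge0. Qed.

Lemma mean_image (f : T' -> R) : (forall t, (0 <= f t)%R) ->
  mean q f = mean p (f \o pi).
Proof.
move=> f0; have p0 := pp.1.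
transitivity (\esum_ t \esum_ x (p x * (pi x == t)%:R * f t)%:E).
  apply: eq_esum => t _; rewrite EFinM im muleC -esumZ //; last first.
    by move=> x; rewrite lee_fin mulr_ge0.
  by apply: eq_esum => x _; rewrite -EFinM mulrC.
rewrite esum_swap; last by move=> t x; rewrite lee_fin !mulr_ge0.
apply: eq_esum => x _; rewrite (@esum_delta _ _ (pi x)) ?eqxx ?mulr1 //.
  by rewrite lee_fin mulr_ge0.
by move=> t /negPf; rewrite eq_sym => ->; rewrite mulr0 mul0r.
Qed.

Lemma image_mass : prob_mass q.
Proof.
split; first exact: image_ge0.
transitivity (mean q (fun=> 1%R)); first by apply: eq_esum => t _; rewrite mulr1.
by rewrite mean_image // -pp.2; apply: eq_esum => x _; rewrite mulr1.
Qed.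

Lemma le_image x : (p x <= q (pi x))%R.
Proof.
rewrite -lee_fin im.
apply: le_trans (esum_ge1 x _); first by rewrite eqxx mulr1.
by move=> y; rewrite lee_fin mulr_ge0 // pp.1.
Qed.

Lemma ent_meanE : ent q = mean p (fun x => - ln (q (pi x)))%R.
Proof.
transitivity (mean q (fun t => - ln (q t))%R).
  by apply: eq_esum => t _; rewrite mulrN.
rewrite mean_image // => t; rewrite oppr_ge0 ln_le0 // mass_le1 //.
exact: image_mass.
Qed.

Lemma ent_image_le : ent q <= ent p.
Proof.
rewrite ent_meanE; apply: le_esum => x _; rewrite lee_fin -mulrN.
have [->|px] := eqVneq (p x) 0%R; first by rewrite !mul0r.
have px0 : (0 < p x)%R by rewrite lt_neqAle eq_sym px pp.1.
rewrite ler_pM2l // lerN2 ler_ln ?posrE ?le_image //.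
exact: lt_le_trans px0 (le_image x).
Qed.

End choice_types.

(** The difference is the relative entropy of p with respect to the product of
its marginals. *)
Lemma ent_joint_le (T T' : choiceType) (p : T * T' -> R) (q : T -> R) (q' : T' -> R) :
  prob_mass p -> is_image fst p q -> is_image snd p q' -> ent p <= ent q + ent q'.
Proof.
move=> pp im im'.
have [q0 q1] := image_mass pp im; have [q'0 q'1] := image_mass pp im'.
have p0 := pp.1.
have lnq z : (0 <= - ln (q z.1))%R.
  by rewrite oppr_ge0 ln_le0 // mass_le1.
have lnq' z : (0 <= - ln (q' z.2))%R.
  by rewrite oppr_ge0 ln_le0 // mass_le1.
have prod1 : \esum_ z (q z.1 * q' z.2)%:E = 1.
  rewrite esum_pair /=; last by move=> z; rewrite lee_fin mulr_ge0.
  rewrite -q1; apply: eq_esum => x _.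
  under eq_esum => y _ do rewrite EFinM.
  by rewrite esumZ ?q'1 ?mule1 // => y; rewrite lee_fin.
have qq0 z : (q z.1 * q' z.2 = 0)%R -> p z = 0%R.
  move=> /eqP; rewrite mulf_eq0 => /orP[] /eqP e; apply/eqP;
    rewrite eq_le p0 andbT -e; exact: (le_image pp).
rewrite -(@leeD2rE _ 1) // -{1}pp.2 -prod1 (ent_meanE pp im) (ent_meanE pp im').
have pent z : (0 <= - (p z * ln (p z)))%R by rewrite entropy_term_ge0 // mass01.
rewrite /ent /mean -!esumD; try by
  move=> z _; rewrite ?adde_ge0 // lee_fin ?mulr_ge0.
apply: le_esum => z _; rewrite -!EFinD lee_fin.
have := kl_ge0 (p0 z) (mulr_ge0 (q0 z.1) (q'0 z.2)) (@qq0 z); rewrite /kl.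
have [->|pz] := eqVneq (p z) 0%R; first by rewrite !mul0r; lra.
have pz0 : (0 < p z)%R by rewrite lt_neqAle eq_sym pz p0.
have qz0 : (0 < q z.1)%R := lt_le_trans pz0 (le_image pp im z).
have q'z0 : (0 < q' z.2)%R := lt_le_trans pz0 (le_image pp im' z).
by rewrite lnM ?posrE //; lra.
Qed.

End images.

Section morphism_images.
Context {R : realType} {H G : groupType} (pi : H -> G).
Hypotheses (piM : forall x y, pi (x * y)%g = (pi x * pi y)%g).

Lemma morph1 : pi 1%g = 1%g.
Proof. by apply: (mulgI (pi 1%g)); rewrite -piM !mulg1. Qed.

Lemma cpow_image (p : H -> R) (q : G -> R) n : prob_mass p -> is_image pi p q ->
  is_image pi (cpow p n) (cpow q n).
Proof.
move=> pp im; have qq := image_mass pp im.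
elim: n => [|n IH] g.
  by rewrite mean_cpow0 // morph1 eq_sym.
rewrite mean_cpowS // cpowS //.
have := @mean_image _ _ _ _ _ _ pp im (fun x => cpow q n (x^-1 * g)%g).
rewrite /mean => -> /=; last by move=> t; exact: cpow_ge0.
apply: eq_esum => h _; rewrite EFinM IH; congr (_ * _); apply: eq_esum => k _.
by rewrite piM -(inj_eq (mulgI (pi h))) mulVKg.
Qed.

End morphism_images.

(** * Lazy walks *)

Section lazy.
Context {R : realType} {G : groupType}.
Implicit Types (p f : G -> R).

(** The law of an increment that is trivial with probability 1/2. Laziness
preserves harmonic functions, images and finiteness of the entropy, and removes
periodicity. *)
Definition lazy p x : R := ((x == 1%g)%:R / 2 + p x / 2)%R.

Lemma mean_lazy p f : prob_mass p -> (forall x, (0 <= f x)%R) ->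
  mean (lazy p) f = (f 1%g / 2)%:E + 2^-1%:E * mean p f.
Proof.
move=> pp f0.
rewrite -esumZ //; last by move=> x; rewrite lee_fin mulr_ge0 // pp.1.
have -> : (f 1%g / 2)%:E = \esum_ x ((x == 1%g)%:R / 2 * f x)%:E.
  rewrite (@esum_delta _ _ 1%g).
  - by rewrite eqxx mul1r mulrC.
  - by rewrite lee_fin !mulr_ge0.
  - by move=> x /negPf ->; rewrite !mul0r.
rewrite -esumD; try by move=> x _; rewrite -?EFinM lee_fin !mulr_ge0 // pp.1.
by apply: eq_esum => x _; rewrite /lazy -EFinM -EFinD; congr (_%:E); ring.
Qed.

Lemma lazy_ge0 p x : prob_mass p -> (0 <= lazy p x)%R.
Proof. by move=> pp; rewrite addr_ge0 // divr_ge0 // pp.1. Qed.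

Lemma lazy_mass p : prob_mass p -> prob_mass (lazy p).
Proof.
move=> pp; split => [x|]; first exact: lazy_ge0.
transitivity (mean (lazy p) (fun=> 1%R)); first by apply: eq_esum => x _; rewrite mulr1.
rewrite mean_lazy // (_ : mean p _ = 1).
  by rewrite mule1 -EFinD; congr (_%:E); lra.
by rewrite -pp.2; apply: eq_esum => x _; rewrite mulr1.
Qed.

Lemma lazy1_gt0 p : prob_mass p -> (0 < lazy p 1%g)%R.
Proof. by move=> [p0 _]; have := p0 1%g; rewrite /lazy eqxx /=; lra. Qed.

Lemma harmonic_lazy p f : prob_mass p -> (forall x, (0 <= f x <= 1)%R) ->
  harmonic (lazy p) f <-> harmonic p f.
Proof.
move=> pp f01; have f0 x : (0 <= f x)%R by case/andP: (f01 x).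
split => hf g; have := hf g; rewrite mean_lazy // mulg1;
  rewrite -(mean_fin (f := fun x => f (g * x)%g) pp) //.
  by rewrite -EFinM -EFinD => -[e]; congr (_%:E); lra.
by move=> -[<-]; rewrite -EFinM -EFinD; congr (_%:E); lra.
Qed.

(** Halving p costs at most p x * ln 2 in each term; at x = 1 the term is
bounded by 1. *)
Lemma ent_lazy p : prob_mass p -> ent p < +oo -> ent (lazy p) < +oo.
Proof.
move=> pp pfin; have [p0 p1] := pp.
have pent x : (0 <= - (p x * ln (p x)))%R by rewrite entropy_term_ge0 // mass01.
have e1 : \esum_(x in [set: G]) (x == 1%g)%:R%:E = 1 :> \bar R.
  by rewrite (@esum_delta _ _ 1%g) ?eqxx ?lee_fin // => x /negPf ->.
have fin : ent p + 1 + 1 < +oo by rewrite !lte_add_pinfty ?ltry.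
apply: le_lt_trans fin; rewrite -{1}p1 -e1 /ent -!esumD; try by
  move=> x _; rewrite ?adde_ge0 // lee_fin.
apply: le_esum => x _; rewrite -!EFinD lee_fin.
have ubound (a : R) : (0 <= a)%R -> (- (a * ln a) <= 1)%R.
  move=> a0; have := @kl_ge0 _ a 1 a0 ler01; rewrite /kl ln1.
  by move=> /(_ (fun e => False_ind _ (negP (oner_neq0 R) (introT eqP e)))); lra.
have [->|x1] := eqVneq x 1%g.
  have := ubound _ (lazy_ge0 1%g pp).
  by have := pent 1%g; have := p0 1%g; rewrite /=; lra.
rewrite /lazy (negPf x1) mul0r add0r addr0.
have [->|px] := eqVneq (p x) 0%R; first by rewrite !mul0r; lra.
have px0 : (0 < p x)%R by rewrite lt_neqAle eq_sym px p0.
rewrite ln_div ?posrE //.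
have ln2 : (ln 2 <= 1 :> R)%R.
  by apply: le_trans (ln_le_sub1 _) _; rewrite ?ltr0n //; lra.
by have := ler_wpM2l (p0 x) ln2; have := pent x; lra.
Qed.

End lazy.

Lemma lazy_image {R : realType} {H G : groupType} (pi : H -> G) (p : H -> R)
    (q : G -> R) :
  pi 1%g = 1%g -> prob_mass p -> is_image pi p q -> is_image pi (lazy p) (lazy q).
Proof.
move=> pi1 pp im g; rewrite mean_lazy // pi1 -im -EFinM -EFinD eq_sym.
by congr (_%:E); rewrite /lazy; ring.
Qed.

(** * Harmonic functions on a product *)

Section product_theorem.
Context {R : realType} {G G' : groupType}.
Variables (p : G * G' -> R) (q : G -> R) (q' : G' -> R).
Hypotheses (pp : prob_mass p) (im : is_image fst p q) (im' : is_image snd p q').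
Hypothesis pfin : ent p < +oo.

(** Constancy on the support of r is enough: applied to the left translates of
f, which are harmonic too, it gives constancy on the set of points attainable
from any given point. *)
Definition trivial_harmonic (H : groupType) (r : H -> R) :=
  forall f, (forall x, (0 <= f x <= 1)%R) -> harmonic r f ->
  forall x, (0 < r x)%R -> f x = f 1%g.

(** Otherwise the informations at x are at least some c > 0 at all times, by
[drift_le_info], and the entropy of the n-th power is at least n * c. It is at
most the sum of the entropies of the marginals, which are o(n) by
[ent_sublinear]. *)
Lemma drift_inf0 :
  (0 < q 1%g)%R -> (0 < q' 1%g)%R ->
  trivial_harmonic q -> trivial_harmonic q' ->
  forall x, (0 < p x)%R -> forall e : R, (0 < e)%R ->
  exists n, drift p n x <= e%:E.
Proof.
move=> q1 q'1 tq tq' x px e e0.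
have qq := image_mass pp im; have qq' := image_mass pp im'.
have qfin := le_lt_trans (ent_image_le pp im) pfin.
have q'fin := le_lt_trans (ent_image_le pp im') pfin.
pose d := (e / 4)%R; have d0 : (0 < d)%R by rewrite divr_gt0.
(* threshold for the information below which the drift is at most e *)
pose c := (d * p x * (e / 2))%R.
have c0 : (0 < c)%R by rewrite !mulr_gt0 // divr_gt0.
have [[n nc]|far] := pselect (exists n, info p n x < c%:E).
  exists n; apply: le_trans (drift_le_info pp n px d0) _.
  rewrite [leRHS](_ : _ = ((d * p x)^-1 * c)%:E + (2 * d)%:E); last first.
    rewrite -EFinD; congr (_%:E); rewrite /c mulKf ?gt_eqF ?mulr_gt0 // /d; lra.
  rewrite leeD2r // EFinM lee_wpmul2l ?lee_fin ?invr_ge0 ?ltW //.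
  by rewrite mulr_gt0.
exfalso; have cinfo k : c%:E <= info p k x.
  by rewrite leNgt; apply/negP => ?; apply: far; exists k.
have grow n := info_ent_le pp pfin n cinfo.
have c4 : (0 < c / 4)%R by rewrite divr_gt0.
have [N [C NC]] := ent_sublinear qq qfin
  (fun y qy => drift_cvg0 qq q1 (fun f f01 hf => tq f f01 hf y qy)) c4.
have [N' [C' NC']] := ent_sublinear qq' q'fin
  (fun y qy => drift_cvg0 qq' q'1 (fun f f01 hf => tq' f f01 hf y qy)) c4.
have bound m : ((N + N' + m)%:R * c <=
    (C + c / 4 * (N' + m)%:R) + (C' + c / 4 * (N + m)%:R))%R.
  rewrite -lee_fin EFinD; apply: le_trans (grow _) _.
  have fstM (a b : G * G') : (a * b)%g.1 = (a.1 * b.1)%g by [].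
  have sndM (a b : G * G') : (a * b)%g.2 = (a.2 * b.2)%g by [].
  apply: le_trans (ent_joint_le (cpow_mass _ pp) (cpow_image fstM _ pp im)
    (cpow_image sndM _ pp im')) _.
  apply: leeD; first by rewrite -addnA.
  by rewrite (addnC N) -addnA.
pose m := Num.bound `|2 * (C + C') / c|%R.
have mb : (2 * (C + C') / c < m%:R)%R.
  by apply: le_lt_trans (ler_norm _) (archi_boundP (normr_ge0 _)).
rewrite ltr_pdivrMr // in mb.
have := bound m; rewrite !natrD.
have := mulr_ge0 (ler0n R N) (ltW c0); have := mulr_ge0 (ler0n R N') (ltW c0).
lra.
Qed.

(** The value f x is a mean over the position at time n.+1 given that the first
increment is x, and f 1 is a mean over that position without this condition.
Apply this to f and 1 - f. *)
Lemma trivial_harmonic_of_drift : (forall x, (0 < p x)%R ->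
  forall e : R, (0 < e)%R -> exists n, drift p n x <= e%:E) ->
  trivial_harmonic p.
Proof.
move=> drift0.
have half f : (forall x, (0 <= f x <= 1)%R) -> harmonic p f ->
    forall x, (0 < p x)%R -> (f x <= f 1%g)%R.
  move=> f01 hf x px; apply/ler_addgt0Pr => e e0.
  have [n ne] := drift0 x px e e0.
  have f0 y : (0 <= f y)%R by case/andP: (f01 y).
  rewrite -lee_fin EFinD (harmonic_cpow n x pp f0 hf).
  apply: le_trans (le_mean_drift n x pp f01) _; apply: leeD => //.
  rewrite (harmonic_cpow n.+1 1%g pp f0 hf) /mean.
  by under [leRHS]eq_esum => y _ do rewrite mul1g.
move=> f f01 hf x px; apply/eqP; rewrite eq_le half //=.
suff : (1 - f x <= 1 - f 1%g)%R by lra.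
apply: (half (fun x => 1 - f x)%R) => // [y|y]; first by have := f01 y; lra.
by rewrite (mean_compl_eq (a := f y)).
Qed.

End product_theorem.

Theorem trivial_harmonic_product {R : realType} {G G' : groupType}
    (p : G * G' -> R) (q : G -> R) (q' : G' -> R) :
  prob_mass p -> is_image fst p q -> is_image snd p q' -> ent p < +oo ->
  trivial_harmonic q -> trivial_harmonic q' -> trivial_harmonic p.
Proof.
move=> pp im im' pfin tq tq'.
have lazy_triv (H : groupType) (r : H -> R) : prob_mass r ->
    trivial_harmonic r -> trivial_harmonic (lazy r).
  move=> rr tr f f01 /(harmonic_lazy rr f01) hf x rx.
  have [->//|x1] := eqVneq x 1%g; apply: tr => //.
  by move: rx; rewrite /lazy (negPf x1) mul0r add0r; lra.
have qq := image_mass pp im; have qq' := image_mass pp im'.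
have := drift_inf0 (lazy_mass pp) (lazy_image _ pp im) (lazy_image _ pp im')
  (ent_lazy pp pfin) (lazy1_gt0 qq) (lazy1_gt0 qq') (lazy_triv _ _ qq tq)
  (lazy_triv _ _ qq' tq').
move=> /(_ erefl erefl) /(trivial_harmonic_of_drift (lazy_mass pp)) tp.
move=> f f01 /(harmonic_lazy pp f01) hf x px; apply: tp => //.
by rewrite /lazy; have : (0 <= (x == 1%g)%:R :> R)%R by []; lra.
Qed.

(** * The space of trajectories *)

Section countable_partition.
Context {R : realType} {d : measure_display} {T : measurableType d} {I : choiceType}.

Lemma measure_partition (m : {measure set T -> \bar R}) (X : T -> I) (E : set T) :
  countable [set: I] -> (forall i, measurable (X @^-1` [set i])) ->
  measurable E -> m E = \esum_ i m (E `&` X @^-1` [set i]).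
Proof.
move=> /countable_injP[f f_inj] mX mE.
have inj_f : set_inj [set: I] f by [].
pose F k := E `&` (f \o X) @^-1` [set k].
have FE i : F (f i) = E `&` X @^-1` [set i].
  congr (_ `&` _); apply/seteqP; split=> x /= => [/f_inj|->//].
  by apply; rewrite inE.
under eq_esum => i _ do rewrite -FE.
rewrite -(@esum_image _ _ _ _ f (fun k => m (F k)) inj_f).
have -> : f @` [set: I] = [set k | k \in f @` [set: I]].
  by apply/seteqP; split=> k /=; rewrite inE.
rewrite -nneseries_esum // -measure_bigcup.
- congr (m _); apply/seteqP; split=> [x Ex|x [k _ []] //].
  by exists (f (X x)); [exists (X x)|split].
- by move=> _ [i _ <-]; rewrite FE; exact: measurableI.
- by move=> i j _ _ [x [[_ /= <-] [_ /= <-]]].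
Qed.

End countable_partition.

Section trajectory_space.
Context {G : groupType}.
Implicit Types (A : nat -> set (discrete_group G)) (h : trajectories G).

Definition rect n A : set (trajectories G) :=
  [set h | forall i, (i < n)%N -> A i (h i)].

Lemma measurable_coordinate n (B : set (discrete_group G)) :
  measurable [set h : trajectories G | B (h n)].
Proof. by apply: sub_sigma_algebra; exists n, B. Qed.

Lemma rectS n A : rect n.+1 A = rect n A `&` [set h | A n (h n)].
Proof.
apply/seteqP; split=> [h Ah|h [Ah An] i]; last first.
  by rewrite ltnS leq_eqVlt => /predU1P[->//|/Ah].
by split=> [i ni|]; apply: Ah => //; rewrite ltnS ltnW.
Qed.

Lemma rect0 A : rect 0 A = setT.
Proof. by apply/seteqP; split. Qed.

Lemma measurable_rect n A : measurable (rect n A).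
Proof.
elim: n => [|n IH]; first by rewrite rect0.
by rewrite rectS; apply: measurableI => //; exact: measurable_coordinate.
Qed.

Lemma measurable_into_trajectories d (T : measurableType d)
    (F : T -> trajectories G) :
  (forall n (B : set (discrete_group G)), measurable [set x | B (F x n)]) ->
  measurable_fun setT F.
Proof.
move=> mF.
have := @measurability _ _ T (trajectories G) setT F (@coordinate_sets G) erefl.
apply.
by move=> _ [_ [n [B ->]] <-]; rewrite setTI; exact: mF.
Qed.

(** Rectangles form a pi-system that generates the sigma-algebra. *)
Lemma trajectory_measure_unique {R : realType}
    (m1 m2 : {measure set (trajectories G) -> \bar R}) :
  (forall n A, m1 (rect n A) = m2 (rect n A)) -> m1 setT < +oo ->
  forall E, measurable E -> m1 E = m2 E.
Proof.
move=> m12 fin E mE.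
pose rects := [set C | exists n A, C = rect n A].
apply: (@g_sigma_algebra_measure_unique _ R _ rects _ (fun=> setT)).
- by move=> _ [n [A ->]]; exact: measurable_rect.
- by move=> _; exists 0%N, (fun=> setT); rewrite rect0.
- by apply/seteqP; split => // x _; exists 0%N.
- move=> _ _ [n [A ->]] [n' [A' ->]].
  exists (maxn n n'),
    (fun i => [set x | ((i < n)%N -> A i x) /\ ((i < n')%N -> A' i x)]).
  apply/seteqP; split=> [h [Ah Ah'] i _|h Ah].
    by split=> ?; [apply: Ah|apply: Ah'].
  split=> i ni; first by apply: (Ah i _).1 => //; rewrite leq_max ni.
  by apply: (Ah i _).2 => //; rewrite leq_max ni orbT.
- by move=> _ [n [A ->]]; exact: m12.
- by [].
- apply: smallest_sub mE; first exact: smallest_sigma_algebra.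
  move=> _ [n [B ->]]; apply: sub_sigma_algebra.
  exists n.+1, (fun i => [set x | i = n -> B x]).
  by apply/seteqP; split=> [h Bh i _ /= ->|h /(_ n (ltnSn n))]; last exact.
Qed.

Definition prepend (x : discrete_group G) h : trajectories G :=
  fun n => if n is m.+1 then h m else x.

Lemma measurable_prepend x : measurable_fun setT (prepend x).
Proof.
apply: measurable_into_trajectories => -[|n] B; last exact: measurable_coordinate.
by have [Bx|nBx] := pselect (B x);
  [rewrite (_ : [set _ | _] = setT)|rewrite (_ : [set _ | _] = set0)] => //;
  apply/seteqP; split.
Qed.

Definition walk_from (g : G) h : trajectories G := fun t => (g * walk h t)%g.

Lemma walk_from1 : walk_from 1%g = @walk G.
Proof. by apply/funext => h; apply/funext => t; rewrite /walk_from mul1g. Qed.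

Lemma walk_from0 g h : walk_from g h 0%N = g.
Proof. by rewrite /walk_from /walk big_ord0 mulg1. Qed.

Lemma walk_from_prepend g x h t :
  walk_from g (prepend x h) t.+1 = walk_from (g * x)%g h t.
Proof.
rewrite /walk_from /walk big_ord_recl /= mulgA; congr (_ * _)%g.
Qed.

Hypothesis countG : countable [set: G].

Lemma measurable_walk_from g : measurable_fun setT (walk_from g).
Proof.
apply: measurable_into_trajectories => t.
elim: t => [|t IH] B.
  under eq_set => h do rewrite walk_from0.
  by have [Bx|nBx] := pselect (B g);
  [rewrite (_ : [set _ | _] = setT)|rewrite (_ : [set _ | _] = set0)] => //;
  apply/seteqP; split.
rewrite (_ : [set _ | _] = \bigcup_(x : G) ([set h | B (walk_from g h t * x)%g] `&`
   [set h : trajectories G | [set x] (h t)])).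
  apply: countable_bigcupT_measurable => // x; apply: measurableI.
    exact: (IH [set y | B (y * x)%g]).
  exact: measurable_coordinate.
have rec h : walk_from g h t.+1 = (walk_from g h t * h t)%g.
  by rewrite /walk_from /walk big_ord_recr /= mulgA.
apply/seteqP; split=> [h /= Bh|h [x _ [/= Bh hx]]].
  by exists (h t) => //; split => //=; rewrite -rec.
by rewrite rec hx.
Qed.

End trajectory_space.

(** * Invariant events and harmonic functions *)

Section random_walk.
Context {R : realType} {G : groupType}.
Hypothesis countG : countable [set: G].
Variables (mu : probability (discrete_group G) R) (Q : probability (trajectories G) R).
Hypothesis iid : iid_law mu Q.

Definition step_mass (x : G) : R := fine (mu [set (x : discrete_group G)]).

Lemma step_massE x : (step_mass x)%:E = mu [set (x : discrete_group G)].
Proof. by rewrite fineK // fin_num_measure. Qed.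

Lemma step_mass_ge0 x : (0 <= step_mass x)%R.
Proof. by rewrite fine_ge0. Qed.

Lemma measure_step_mass (B : set (discrete_group G)) :
  mu B = \esum_ x (step_mass x * (x \in B)%:R)%:E.
Proof.
rewrite (@measure_partition _ _ _ G mu (fun x : G => x)) //.
apply: eq_esum => x _; rewrite EFinM step_massE preimage_id.
have [Bx|nBx] := boolP (x \in B).
  by rewrite mule1 setIidr // => y /= ->; rewrite -inE.
rewrite mule0 (_ : _ `&` _ = set0) ?measure0 //.
by apply/seteqP; split=> // y [By /= yx]; move: nBx; rewrite -yx mem_set.
Qed.

Lemma step_mass_mass : prob_mass step_mass.
Proof.
split; first exact: step_mass_ge0.
rewrite -(@probability_setT _ _ _ mu) measure_step_mass.
by apply: eq_esum => x _; rewrite in_setT mulr1.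
Qed.

Lemma first_coordinate (x : G) : Q [set h : trajectories G | h 0%N = x] = mu [set x].
Proof.
have := iid 1%N (fun=> [set x]); rewrite big_ord1 => <-; congr (Q _).
by apply/seteqP; split=> h /= => [? [|]//|]; apply.
Qed.

(** The Markov property. Both sides are measures in E, and the law of the
increments gives their values on rectangles. *)
Lemma first_step (x : G) E : measurable E ->
  Q (E `&` [set h : trajectories G | h 0%N = x]) =
  (step_mass x)%:E * Q (prepend x @^-1` E).
Proof.
move=> mE.
have mD : measurable [set h : trajectories G | h 0%N = x].
  exact: (measurable_coordinate 0 [set x]).
pose c : {nonneg R}%R := NngNum (step_mass_ge0 x).
pose pre := mfun_Sub (mem_set (measurable_prepend x) :
  (prepend x : trajectories G -> trajectories G) \in mfun).
apply: (@trajectory_measure_unique _ _ (mrestr Q mD)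
  (mscale c (distribution Q pre))) => // [n A|]; last first.
  rewrite /= /mrestr setTI; apply: le_lt_trans (probability_le1 Q mD) _.
  exact: ltry.
change (Q (rect n A `&` [set h : trajectories G | h 0%N = x]) =
  (step_mass x)%:E * Q (prepend x @^-1` rect n A)).
case: n => [|n].
  by rewrite !rect0 setTI preimage_setT probability_setT mule1
    first_coordinate step_massE.
pose A' i := if i is j.+1 then A i else A 0%N `&` [set x].
have -> : rect n.+1 A `&` [set h : trajectories G | h 0%N = x] = rect n.+1 A'.
  apply/seteqP; split=> [h [Ah hx] [|i] ni|h Ah]; [split => //; exact: Ah|exact: Ah|].
  have [A0 hx] := Ah 0%N isT.
  by split=> // -[|i] ni //; exact: (Ah i.+1).
rewrite iid big_ord_recl /= -/(rect n.+1 A) step_massE.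
have [Ax|nAx] := pselect (A 0%N x).
  rewrite (_ : A 0%N `&` _ = [set x]); last by rewrite setIidr // => _ ->.
  rewrite (_ : _ @^-1` _ = rect n (fun i => A i.+1)) ?iid //.
  by apply/seteqP; split=> [h Ah i ni|h Ah [|i] ni //]; [exact: (Ah i.+1)|exact: Ah].
rewrite (_ : A 0%N `&` _ = set0); last first.
  by apply/seteqP; split=> // y [Ay /= yx]; apply: nAx; rewrite -yx.
rewrite (_ : _ @^-1` _ = set0) ?measure0 ?mule0 ?mul0e //.
by apply/seteqP; split=> // h /(_ 0%N isT).
Qed.

Lemma one_step E : measurable E ->
  Q E = \esum_ x ((step_mass x)%:E * Q (prepend x @^-1` E)).
Proof.
move=> mE.
rewrite (measure_partition (X := fun h : trajectories G => h 0%N : G) Q countG) //.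
  by apply: eq_esum => x _; rewrite -first_step.
by move=> x; exact: (measurable_coordinate 0 [set x]).
Qed.

End random_walk.

Section zero_one.
Context {R : realType} {G : groupType}.
Hypothesis countG : countable [set: G].
Variables (mu : probability (discrete_group G) R) (Q : probability (trajectories G) R).
Hypothesis iid : iid_law mu Q.

Local Notation p := (step_mass mu).

Lemma measurable_walk_from_preimage g (A : set (trajectories G)) :
  measurable A -> measurable (walk_from g @^-1` A).
Proof.
by move=> mA; rewrite -[X in measurable X]setTI; exact: measurable_walk_from.
Qed.

Lemma prepend_walk_from g x (A : set (trajectories G)) :
  @time_shift G @^-1` A = A ->
  prepend x @^-1` (walk_from g @^-1` A) = walk_from (g * x)%g @^-1` A.
Proof.
move=> invA; rewrite -{1}invA; apply/seteqP.
have e h : time_shift (walk_from g (prepend x h)) = walk_from (g * x)%g h.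
  by apply/funext => t; rewrite /time_shift walk_from_prepend.
by split=> h /=; rewrite e.
Qed.

(** Let f g be the probability of A for the walk that starts at g. By invariance
of A it is harmonic, so it keeps its value along the steps of the walk, which
makes A independent of each rectangle of increments. By uniqueness of measures
A is independent of itself. *)
Lemma shift_invariant_zero_one (A : set (trajectories G)) :
  trivial_harmonic p -> measurable A -> @time_shift G @^-1` A = A ->
  Q (@walk G @^-1` A) = 0 \/ Q (@walk G @^-1` A) = 1.
Proof.
move=> triv mA invA.
have p_mass := step_mass_mass countG mu.
pose E g := walk_from g @^-1` A.
have mE g : measurable (E g) by exact: measurable_walk_from_preimage.
pose f g := fine (Q (E g)).
have fE g : (f g)%:E = Q (E g) by rewrite fineK // fin_num_measure.
have f01 g : (0 <= f g <= 1)%R.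
  by rewrite -!lee_fin fE measure_ge0 probability_le1.
have hf : harmonic p f.
  move=> g; rewrite fE (one_step countG iid) //; apply: eq_esum => x _.
  by rewrite prepend_walk_from // EFinM fE.
have f_const g x : (0 < p x)%R -> f (g * x)%g = f g.
  move=> px; rewrite -[in RHS](mulg1 g).
  apply: (triv (fun y => f (g * y)%g)) => // y.
  by rewrite hf; apply: eq_esum => z _; rewrite mulgA.
have indep n B g : Q (rect n B `&` E g) = Q (rect n B) * Q (E g).
  elim: n B g => [|n IH] B g; first by rewrite rect0 setTI probability_setT mul1e.
  rewrite (one_step countG iid); last exact: measurableI (measurable_rect _ _) (mE g).
  have step x : (p x)%:E * Q (prepend x @^-1` (rect n.+1 B `&` E g)) =
      Q (E g) * (Q (rect n (fun i => B i.+1)) * (p x * (x \in B 0%N)%:R)%:E).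
    rewrite preimage_setI prepend_walk_from //.
    have [px|px] := eqVneq (p x) 0%R; first by rewrite px mul0r mul0e !mule0.
    have px0 : (0 < p x)%R by rewrite lt_neqAle eq_sym px step_mass_ge0.
    have [Bx|nBx] := boolP (x \in B 0%N).
      have -> : prepend x @^-1` rect n.+1 B = rect n (fun i => B i.+1).
        apply/seteqP; split=> [h Bh i ni|h Bh [|i] ni]; first exact: (Bh i.+1).
          by move: Bx; rewrite inE.
        exact: Bh.
      rewrite IH -[Q (E _)]fE f_const // fE mulr1.
      by rewrite [RHS]muleC [_ * (p x)%:E]muleC muleA.
    have -> : prepend x @^-1` rect n.+1 B = set0.
      by apply/seteqP; split=> // h /(_ 0%N isT) /= Bx; move: nBx; rewrite mem_set.
    by rewrite set0I measure0 mulr0 !mule0.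
  have m0 x : 0 <= (p x * (x \in B 0%N)%:R)%:E.
    by rewrite lee_fin mulr_ge0 // step_mass_ge0.
  under eq_esum => x _ do rewrite step.
  set r := Q (rect n _).
  have rE : r = (fine r)%:E.
    by rewrite fineK //; apply: fin_num_measure; exact: measurable_rect.
  have r0 : (0 <= fine r)%R by apply: fine_ge0; exact: measure_ge0.
  have fg0 : (0 <= f g)%R by case/andP: (f01 g).
  rewrite -(fE g) rE (esumZ fg0); last by move=> x; rewrite mule_ge0 // lee_fin.
  rewrite (esumZ r0) // -(measure_step_mass countG) -rE /r !iid.
  by rewrite [in RHS]big_ord_recl /= muleC [mu _ * _]muleC.
pose c : {nonneg R}%R := NngNum (proj1 (andP (f01 1%g))).
have sq : Q (E 1%g `&` E 1%g) = (f 1%g)%:E * Q (E 1%g).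
  apply: (@trajectory_measure_unique _ _ (mrestr Q (mE 1%g)) (mscale c Q)) => //.
    by move=> n B; rewrite /= /mrestr /mscale indep muleC fE.
  rewrite /= /mrestr setTI; apply: le_lt_trans (probability_le1 Q (mE 1%g)) _.
  exact: ltry.
move: sq; rewrite setIid -fE -EFinM => -[fsq].
rewrite -walk_from1 -/(E 1%g) -fE.
have : (f 1%g * (1 - f 1%g) = 0)%R by rewrite mulrBr mulr1 -fsq subrr.
move=> /eqP; rewrite mulf_eq0 => /orP[/eqP ->|]; first by left.
by rewrite subr_eq0 => /eqP <-; right.
Qed.

End zero_one.

Section liouville_harmonic.
Context {R : realType} {G : groupType}.
Hypothesis countG : countable [set: G].
Variables (mu : probability (discrete_group G) R) (Q : probability (trajectories G) R).
Hypothesis iid : iid_law mu Q.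

Local Notation p := (step_mass mu).

Definition hits_by (B : set G) N : set (trajectories G) :=
  \bigcup_(n in [set n | (n <= N)%N]) [set w : trajectories G | B (w n)].

Definition hits_from (B : set G) N : set (trajectories G) :=
  \bigcup_n [set w : trajectories G | B (w (N + n)%N)].

Definition hits_io (B : set G) : set (trajectories G) := \bigcap_N hits_from B N.

Lemma measurable_hits_by B N : measurable (hits_by B N).
Proof. by apply: bigcup_measurable => n _; exact: measurable_coordinate. Qed.

Lemma measurable_hits_from B N : measurable (hits_from B N).
Proof. by apply: bigcup_measurable => n _; exact: measurable_coordinate. Qed.

Lemma measurable_hits_io B : measurable (hits_io B).
Proof. by apply: bigcap_measurable => // n _; exact: measurable_hits_from. Qed.

Lemma hits_io_shift B : @time_shift G @^-1` hits_io B = hits_io B.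
Proof.
apply/seteqP; split=> w wB N _.
  by have [n _ Bn] := wB N I; exists n.+1 => //=; rewrite addnS.
by have [n _ Bn] := wB N.+1 I; exists n => //; rewrite /time_shift /= -addSn.
Qed.

Variables (f : G -> R) (t : R).
Hypotheses (f01 : forall g, (0 <= f g <= 1)%R) (hf : harmonic p f) (t0 : (0 < t)%R).

Let B : set G := [set g | (t <= f g)%R].
Let p_mass : prob_mass p := step_mass_mass countG mu.
Let p0 x : (0 <= p x)%R := step_mass_ge0 mu x.

(** Induction on the horizon N: if f g < t the walk makes one step, and f g is
the mean of f after that step. *)
Lemma ville N g : Q (walk_from g @^-1` hits_by B N) <= (f g / t)%:E.
Proof.
elim: N g => [|N IH] g.
all: have [Bg|nBg] := pselect (B g).
1,3: apply: le_trans (probability_le1 Q _) _;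
  [exact: measurable_walk_from_preimage (measurable_hits_by _ _)|
   by rewrite lee_fin ler_pdivlMr // mul1r].
  rewrite (_ : _ @^-1` _ = set0) ?measure0.
    by rewrite lee_fin divr_ge0 ?(ltW t0) //; case/andP: (f01 g).
  apply/seteqP; split=> // h [n /=]; rewrite leqn0 => /eqP ->.
  by rewrite walk_from0.
rewrite (one_step countG iid); last first.
  exact: measurable_walk_from_preimage (measurable_hits_by _ _).
have -> : (f g / t)%:E = \esum_ x (p x * (f (g * x)%g / t))%:E.
  have tV0 : (0 <= t^-1)%R by rewrite invr_ge0 ltW.
  rewrite mulrC EFinM hf -(esumZ tV0); last first.
    by move=> x; rewrite lee_fin mulr_ge0 //; case/andP: (f01 (g * x)%g).
  by apply: eq_esum => x _; rewrite -EFinM; congr (_%:E); ring.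
apply: le_esum => x _; rewrite EFinM lee_wpmul2l ?lee_fin //.
apply: le_trans (IH (g * x)%g); apply: le_measure; rewrite ?inE.
- rewrite -[X in measurable X]setTI; apply: measurable_prepend => //.
  exact: measurable_walk_from_preimage (measurable_hits_by _ _).
- exact: measurable_walk_from_preimage (measurable_hits_by _ _).
- move=> h [[|n] /= nN]; first by rewrite walk_from0.
  by rewrite walk_from_prepend => Bn; exists n.
Qed.

Lemma hits_io_le g : Q (walk_from g @^-1` hits_io B) <= (f g / t)%:E.
Proof.
have mH N := measurable_walk_from_preimage countG g (measurable_hits_by B N).
have mU : measurable (\bigcup_N (walk_from g @^-1` hits_by B N)).
  by apply: bigcup_measurable => N _.
apply: (@le_trans _ _ (Q (\bigcup_N (walk_from g @^-1` hits_by B N)))).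
  apply: le_measure; rewrite ?inE //.
    exact: measurable_walk_from_preimage (measurable_hits_io B).
  by move=> h /(_ 0%N I) [n _ /= Bn]; exists n => //; exists n => /=.
apply: (cvge_to_le (nondecreasing_cvg_mu (mu := Q) mH mU _)).
  move=> i j ij; apply/subsetPset => h [n /= ni Bn]; exists n => //=.
  exact: leq_trans ij.
by apply: nearW => N /=; exact: ville.
Qed.

(** The mean of f at time n is f g, and f is at most 1 on B and at most t
elsewhere. *)
Lemma hits_at_ge n g : (f g - t)%:E <= Q (walk_from g @^-1` [set w | B (w n)]).
Proof.
have mB k h : measurable (walk_from h @^-1` [set w | B (w k)]).
  exact: measurable_walk_from_preimage (measurable_coordinate _ _).
elim: n g => [|n IH] g.
  have [Bg|nBg] := pselect (B g).
    rewrite (_ : _ @^-1` _ = setT); last first.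
      by apply/seteqP; split => // h _; rewrite /= walk_from0.
    by rewrite probability_setT lee_fin; have := f01 g; have := t0; lra.
  apply: le_trans (measure_ge0 _ _); rewrite lee_fin.
  by move/negP: nBg; rewrite /= -ltNge subr_le0 => /ltW.
rewrite EFinB leeBlDr // (one_step countG iid) // hf.
have -> : t%:E = \esum_ x (p x * t)%:E.
  under eq_esum => x _ do rewrite mulrC EFinM.
  by rewrite esumZ ?p_mass.2 ?mule1 ?(ltW t0) // => x; rewrite lee_fin.
rewrite -esumD; first last.
- by move=> x _; rewrite lee_fin mulr_ge0 // ltW.
- by move=> x _; rewrite mule_ge0 ?lee_fin.
apply: le_esum => x _; rewrite !EFinM -ge0_muleDr ?lee_fin ?(ltW t0) //.
rewrite lee_wpmul2l ?lee_fin // -leeBlDr // -EFinB.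
apply: le_trans (IH (g * x)%g) _; apply: le_measure; rewrite ?inE //.
  by rewrite -[X in measurable X]setTI; exact: measurable_prepend.
by move=> h /=; rewrite walk_from_prepend.
Qed.

Lemma hits_io_ge g : (f g - t)%:E <= Q (walk_from g @^-1` hits_io B).
Proof.
have mH N := measurable_walk_from_preimage countG g (measurable_hits_from B N).
have mI : measurable (\bigcap_N (walk_from g @^-1` hits_from B N)).
  by apply: bigcap_measurable => // N _.
rewrite (_ : _ @^-1` _ = \bigcap_N (walk_from g @^-1` hits_from B N)) //.
apply: (cvge_to_ge (nonincreasing_cvg_mu (mu := Q) _ mH mI _)).
- by apply: le_lt_trans (probability_le1 Q (mH _)) (ltry _).
- move=> i j ij; apply/subsetPset => h [n _ /= Bn]; exists (j + n - i)%N => //=.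
  by rewrite subnKC // (leq_trans ij) // leq_addr.
- apply: nearW => N /=; apply: le_trans (hits_at_ge N g) _.
  apply: le_measure; rewrite ?inE //.
    exact: measurable_walk_from_preimage (measurable_coordinate _ _).
  by move=> h /= Bn; exists 0%N; rewrite //= addn0.
Qed.

End liouville_harmonic.

(** If f took values f x1 < f x2 at two increments of positive mass, let t be
between them. The invariant event that f is at least t infinitely often has
probability less than 1 after the step x1 and positive probability after the
step x2, so its probability is neither 0 nor 1. Hence f is constant on the
support, and f 1 is the mean of that constant. *)
Lemma trivial_harmonic_of_zero_one {R : realType} {G : groupType}
    (countG : countable [set: G]) (mu : probability (discrete_group G) R)
    (Q : probability (trajectories G) R) :
  iid_law mu Q ->
  (forall A : set (trajectories G), measurable A -> @time_shift G @^-1` A = A ->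
    Q (@walk G @^-1` A) = 0 \/ Q (@walk G @^-1` A) = 1) ->
  trivial_harmonic (step_mass mu).
Proof.
move=> iid zo f f01 hf.
set p := step_mass mu.
have p_mass : prob_mass p := step_mass_mass countG mu.
have p0 := p_mass.1.
have le_f x1 x2 : (0 < p x1)%R -> (0 < p x2)%R -> (f x2 <= f x1)%R.
  move=> px1 px2; rewrite leNgt; apply/negP => f12.
  pose t := ((f x1 + f x2) / 2)%R.
  have f1t : (f x1 < t)%R by rewrite /t; lra.
  have tf2 : (t < f x2)%R by rewrite /t; lra.
  have t0 : (0 < t)%R by have := f01 x1; lra.
  pose A := hits_io [set g | (t <= f g)%R].
  have mA : measurable A by exact: measurable_hits_io.
  have mE g : measurable (walk_from g @^-1` A).
    exact: measurable_walk_from_preimage.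
  pose a g := fine (Q (walk_from g @^-1` A)).
  have aE g : (a g)%:E = Q (walk_from g @^-1` A) by rewrite fineK // fin_num_measure.
  have a01 g : (0 <= a g <= 1)%R.
    by rewrite -!lee_fin aE measure_ge0 probability_le1.
  have Q1 : Q (@walk G @^-1` A) = mean p a.
    rewrite -walk_from1 (one_step countG iid) //; apply: eq_esum => x _.
    by rewrite prepend_walk_from ?hits_io_shift // mul1g EFinM aE.
  have a1 : (a x1 < 1)%R.
    rewrite -lte_fin aE; apply: le_lt_trans (hits_io_le countG iid f01 hf t0 x1) _.
    by rewrite lte_fin ltr_pdivrMr // mul1r.
  have a2 : (0 < a x2)%R.
    rewrite -lte_fin aE; apply: lt_le_trans (hits_io_ge countG iid f01 hf t0 x2).
    by rewrite lte_fin subr_gt0.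
  have pos (b : G -> R) x : (0 < p x)%R -> (0 < b x)%R -> (forall y, (0 <= b y)%R) ->
      0 < mean p b.
    move=> px bx b0; apply: lt_le_trans (esum_ge1 x _).
      by rewrite lte_fin mulr_gt0.
    by move=> y; rewrite lee_fin mulr_ge0.
  have [Q0|Q1'] := zo A mA (hits_io_shift _).
    have : 0 < mean p a by apply: (pos _ x2) => // y; case/andP: (a01 y).
    by rewrite -Q1 Q0 ltxx.
  have : 0 < mean p (fun x => 1 - a x)%R.
    by apply: (pos _ x1) => // [|y]; [rewrite subr_gt0|have := a01 y; lra].
  by rewrite (mean_compl_eq p_mass a01 (a := 1%R)) -?Q1 // subrr ltxx.
move=> x px.
have : mean p f = mean p (fun=> f x).
  apply: eq_esum => y _; congr (_%:E).
  have [->|py] := eqVneq (p y) 0%R; first by rewrite !mul0r.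
  have py0 : (0 < p y)%R by rewrite lt_neqAle eq_sym py p0.
  by congr (_ * _)%R; apply/eqP; rewrite eq_le !le_f.
have -> : mean p (fun=> f x) = (f x)%:E.
  rewrite /mean; under eq_esum => y _ do rewrite mulrC EFinM.
  by rewrite esumZ ?p_mass.2 ?mule1 //; case/andP: (f01 x).
have -> : mean p f = (f 1%g)%:E.
  by rewrite (hf 1%g); apply: eq_esum => y _; rewrite mul1g.
by move=> [].
Qed.

(** * Existence of independent increments *)

Section as_probability.
Context {R : realType} {d : measure_display} {T : measurableType d}.
Variable m : {measure set T -> \bar R}.

Definition as_probability of m setT = 1 : set T -> \bar R := m.

Hypothesis m1 : m setT = 1.

HB.instance Definition _ := Measure.on (as_probability m1).
HB.instance Definition _ :=
  @Measure_isProbability.Build _ _ _ (as_probability m1) m1.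

End as_probability.

Section digits.
Context {R : realType}.
Variable q : nat -> R.
Hypothesis qq : prob_mass q.

Local Open Scope ring_scope.

Definition cumul k : R := \sum_(i < k) q i.

(** The unit interval is cut into consecutive cells of lengths q 0, q 1, ...;
[digit] names the cell of a point, and [rescale] stretches that cell back to
the unit interval. *)
Definition digit (x : R) : nat :=
  xget 0%N [set k | cumul k <= x < cumul k.+1].

Definition rescale (x : R) : R := (x - cumul (digit x)) / q (digit x).

Lemma cumulS k : cumul k.+1 = cumul k + q k.
Proof. by rewrite /cumul big_ord_recr. Qed.

Lemma cumul_le k k' : (k <= k')%N -> cumul k <= cumul k'.
Proof.
move=> /subnK <-; elim: (k' - k)%N => [//|j IH].
by rewrite addSn cumulS (le_trans IH) // lerDl qq.1.
Qed.

Lemma digit_unique x k : cumul k <= x < cumul k.+1 -> digit x = k.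
Proof.
move=> xk; apply: xget_unique => //= j xj.
have aux a b : cumul a <= x < cumul a.+1 -> cumul b <= x < cumul b.+1 -> (a <= b)%N.
  move=> /andP[ax _] /andP[_ xb]; rewrite leqNgt; apply/negP => /cumul_le.
  by move=> /(le_trans)/(_ ax) /le_lt_trans/(_ xb); rewrite ltxx.
by apply/eqP; rewrite eqn_leq !aux.
Qed.

Lemma digit_exists x : 0 <= x < 1 -> exists k, cumul k <= x < cumul k.+1.
Proof.
move=> /andP[x0 x1].
have ex : exists K, x < cumul K.
  apply: contrapT => h; have le_x K : cumul K <= x.
    by rewrite leNgt; apply/negP => ?; apply: h; exists K.
  have : (\sum_(i <oo) (q i)%:E <= x%:E)%E.
    apply: lime_le; first by apply: is_cvg_nneseries => i _ _; rewrite lee_fin qq.1.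
    by apply: nearW => K; rewrite sumEFin lee_fin big_mkord le_x.
  rewrite nneseries_esumT ?qq.2 ?lee_fin; last by move=> i; rewrite lee_fin qq.1.
  by rewrite leNgt x1.
case: (ex_minnP ex) => -[|k] xk min_k.
  by move: xk; rewrite /cumul big_ord0 ltNge x0.
exists k; rewrite xk andbT leNgt; apply/negP => /min_k.
by rewrite ltnn.
Qed.

Lemma measurable_digit (B : set nat) : measurable (digit @^-1` B).
Proof.
have mI k : measurable [set x : R | cumul k <= x < cumul k.+1].
  have -> : [set x : R | cumul k <= x < cumul k.+1] = [set` `[cumul k, cumul k.+1[].
    by apply/seteqP; split=> x /=; rewrite in_itv.
  exact: measurable_itv.
have mU := bigcup_measurable (fun k (_ : B k) => mI k).
have mN := measurableC (bigcup_measurable (fun k (_ : setT k) => mI k)).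
have -> : digit @^-1` B =
    \bigcup_(k in B) [set x : R | cumul k <= x < cumul k.+1] `|`
    ((~` \bigcup_k [set x : R | cumul k <= x < cumul k.+1]) `&` [set x | B 0%N]).
  apply/seteqP; split=> [x /= Bx|x [[k Bk /= /digit_unique ->//]|[nx B0]]].
    have [ex|nex] := pselect (exists k, cumul k <= x < cumul k.+1).
      by left; case: ex => k xk; exists k => //; rewrite -(digit_unique xk).
    right; split=> [[k _ /= xk]|]; first by apply: nex; exists k.
    move: Bx; rewrite /digit xgetPN // => k xk.
    by apply: nex; exists k.
  rewrite /digit /= xgetPN // => k xk; by apply: nx; exists k.
apply: measurableU => //; apply: measurableI => //.
have [B0|nB0] := pselect (B 0%N).
  by rewrite (_ : [set _ | _] = setT) //; apply/seteqP; split.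
by rewrite (_ : [set _ | _] = set0) //; apply/seteqP; split.
Qed.

Lemma measurable_affine (c l : R) : measurable_fun setT (fun x : R => (x - c) / l).
Proof. by apply: measurable_funM => //; apply: measurable_funB. Qed.

Lemma measurable_rescale : measurable_fun setT rescale.
Proof.
move=> _ B mB; rewrite setTI.
rewrite (_ : _ @^-1` _ = \bigcup_k (digit @^-1` [set k] `&`
    (fun x => (x - cumul k) / q k) @^-1` B)).
  apply: bigcup_measurable => k _; apply: measurableI; first exact: measurable_digit.
  by rewrite -[X in measurable X]setTI; exact: measurable_affine.
apply/seteqP; split=> [x Bx|x [k _ [/= <- Bx]]] //.
by exists (digit x).
Qed.

Definition nth_digit i x : nat := digit (iter i rescale x).

Lemma measurable_nth_digit i (B : set nat) : measurable (nth_digit i @^-1` B).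
Proof.
have mit : measurable_fun setT (iter i rescale : R -> R).
  elim: i => [|i IH]; first exact: measurable_id.
  by rewrite (_ : iter _ _ = rescale \o iter i rescale) //;
    apply: measurableT_comp measurable_rescale IH.
rewrite -[X in measurable X]setTI.
exact: (mit measurableT (digit @^-1` B) (measurable_digit B)).
Qed.

Lemma cumul_le1 k : cumul k <= 1.
Proof.
rewrite -lee_fin -qq.2 -nneseries_esumT; last by move=> i; rewrite lee_fin qq.1.
rewrite /cumul -(big_mkord xpredT) -sumEFin.
by apply: nneseries_lim_ge => i _ _; rewrite lee_fin qq.1.
Qed.

Lemma prod_esum_fin n (B : nat -> set nat) :
  ((\prod_(i < n) \esum_(k in B i) (q k)%:E) \is a fin_num)%E.
Proof.
apply: (big_ind (fun z : \bar R => z \is a fin_num)) => // [x y|i _].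
  exact: fin_numM.
rewrite ge0_fin_numE; last by apply: esum_ge0 => k _; rewrite lee_fin qq.1.
apply: le_lt_trans (ltry 1); rewrite -qq.2 esum_mkcond; apply: le_esum => k _.
by case: ifP => // _; rewrite lee_fin qq.1.
Qed.

(** The interval from c to c + l of an arbitrary position and length takes the
place of the unit interval, because the cells of such an interval are again of
that form: this is what the induction on n runs over. *)
Lemma lebesgue_digits n (B : nat -> set nat) (c l : R) : 0 < l ->
  (lebesgue_measure ([set x | c <= x < c + l]%R `&`
     [set x | forall i, (i < n)%N -> B i (nth_digit i ((x - c) / l))]) =
   l%:E * \prod_(i < n) \esum_(k in B i) (q k)%:E)%E.
Proof.
have itvE a b : [set x : R | a <= x < b] = [set` `[a, b[].
  by apply/seteqP; split=> x /=; rewrite in_itv.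
have q0 := qq.1.
elim: n B c l => [|n IH] B c l l0.
  rewrite big_ord0 mule1 (_ : [set x | forall i, _] = setT) ?setIT; last first.
    by apply/seteqP; split.
  rewrite itvE lebesgue_measure_itv /= lte_fin ltrDl l0 -EFinB.
  by congr (_%:E); ring.
pose F k := [set x | c + l * cumul k <= x < c + l * cumul k + l * q k] `&`
  [set x | forall i, (i < n)%N ->
     B i.+1 (nth_digit i ((x - (c + l * cumul k)) / (l * q k)))].
have in_cell x k : (c + l * cumul k <= x < c + l * cumul k + l * q k) =
    (cumul k <= (x - c) / l < cumul k.+1).
  rewrite ler_pdivlMr // ltr_pdivrMr // cumulS.
  by congr andb; apply/idP/idP => ?; lra.
have shift_digit x k i : digit ((x - c) / l) = k ->
    nth_digit i.+1 ((x - c) / l) =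
    nth_digit i ((x - (c + l * cumul k)) / (l * q k)).
  move=> dk; rewrite /nth_digit iterSr; congr (digit (iter i rescale _)).
  rewrite /rescale dk invfM mulrA; congr (_ * _).
  by field; rewrite gt_eqF.
have split_cells : [set x | c <= x < c + l] `&`
    [set x | forall i, (i < n.+1)%N -> B i (nth_digit i ((x - c) / l))] =
    \bigcup_(k in B 0%N) F k.
  apply/seteqP; split=> [x [/= xcl xB]|x [k Bk [/= xk xB]]].
    have [k xk] : exists k, cumul k <= (x - c) / l < cumul k.+1.
      by apply: digit_exists; rewrite ler_pdivlMr // ltr_pdivrMr //; lra.
    have dk := digit_unique xk.
    exists k; first by rewrite -dk; exact: (xB 0%N).
    split=> /= [|i ni]; first by rewrite in_cell.
    by rewrite -(shift_digit x k i dk); exact: xB.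
  rewrite in_cell in xk; have dk := digit_unique xk.
  split=> /= [|[|i] ni]; last 2 first.
  - by rewrite /nth_digit /= dk.
  - by rewrite (shift_digit x k i dk); exact: xB.
  have y0 : 0 <= (x - c) / l.
    case/andP: xk => h _; apply: le_trans h.
    by apply: (le_trans _ (cumul_le (leq0n k))); rewrite /cumul big_ord0.
  have y1 : (x - c) / l < 1.
    by case/andP: xk => _ h; apply: lt_le_trans h (cumul_le1 _).
  by move: y0 y1; rewrite ler_pdivlMr // ltr_pdivrMr //; lra.
rewrite split_cells measure_bigcup; first last.
- move=> i j _ _ [x [[/= xi _] [/= xj _]]].
  by rewrite !in_cell in xi xj; rewrite -(digit_unique xi) (digit_unique xj).
- move=> k _; apply: measurableI; first by rewrite itvE; exact: measurable_itv.
  rewrite (_ : [set x | _] = \bigcap_(i in [set i | (i < n)%N])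
    ((fun x : R => (x - (c + l * cumul k)) / (l * q k)) @^-1`
      (nth_digit i @^-1` B i.+1))) //.
  apply: bigcap_measurableType => i _.
  rewrite -[X in measurable X]setTI.
  by apply: measurable_affine => //; exact: measurable_nth_digit.
rewrite nneseries_esum // set_mem_set big_ord_recl.
have := prod_esum_fin n (fun i => B i.+1).
set P := (\prod_(i < n) _)%E => Pfin; have P0 : (0 <= P)%E.
  by apply: prode_ge0 => i _; apply: esum_ge0 => k _; rewrite lee_fin.
transitivity (\esum_(k in B 0%N) ((l * fine P)%:E * (q k)%:E)%E).
  apply: eq_esum => k _; rewrite EFinM fineK //.
  have [qk|qk] := eqVneq (q k) 0.
    rewrite qk mule0 (_ : F k = set0) ?measure0 //.
    by apply/seteqP; split=> // x [/= + _]; rewrite qk; lra.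
  have lq0 : 0 < l * q k by rewrite mulr_gt0 // lt_neqAle eq_sym qk q0.
  transitivity ((l * q k)%:E * P)%E; first exact: (IH (fun i => B i.+1) _ _ lq0).
  by rewrite EFinM muleAC.
rewrite esumZ ?mulr_ge0 ?(ltW l0) ?fine_ge0 //.
by rewrite EFinM fineK // -muleA [(P * _)%E]muleC.
Qed.

End digits.

Section iid_existence.
Context {R : realType} {G : groupType}.
Hypothesis countG : countable [set: G].
Variable mu : probability (discrete_group G) R.

(** Number the elements of G and take the elements whose numbers are the successive
digits of a uniform point of the unit interval. *)
Lemma iid_exists : exists Q : probability (trajectories G) R, iid_law mu Q.
Proof.
have /countable_injP[f f_inj] := countG.
have inj_f x y : f x = f y -> x = y by apply: f_inj; rewrite inE.
pose r k : G := xget 1%g [set g | f g = k].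
have rf g : r (f g) = g by apply: xget_unique => // y /= /inj_f.
pose q k := fine (mu [set g | f g = k]).
have qE k : (q k)%:E = mu [set g | f g = k] by rewrite fineK // fin_num_measure.
have muE (A : set (discrete_group G)) : mu A = \esum_(k in [set k | A (r k)]) (q k)%:E.
  rewrite (@measure_partition _ _ _ nat mu f) //; last exact: countableP.
  rewrite [RHS]esum_mkcond; apply: eq_esum => k _; rewrite qE.
  case: ifPn => [|/negP]; rewrite inE /= => Ark.
    congr (mu _); apply/seteqP; split=> [x []|x /= fx] //.
    by split=> //; rewrite -(rf x) fx.
  rewrite (_ : _ `&` _ = set0) ?measure0 //.
  by apply/seteqP; split=> // x [Ax /= fx]; apply: Ark; rewrite -fx rf.
have q_mass : prob_mass q.
  split=> [k|]; first exact: fine_ge0.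
  by rewrite -(@probability_setT _ _ _ mu) muE; congr esum; apply/seteqP; split.
have mI : measurable ([set x | 0 <= x < 1]%R : set (measurableTypeR R)).
  rewrite (_ : mkset _ = [set` `[0%R, 1%R[]); first exact: measurable_itv.
  by apply/seteqP; split=> x /=; rewrite in_itv.
have mass1 : mrestr lebesgue_measure mI setT = 1.
  rewrite /mrestr setTI (_ : mkset _ = [set` `[0%R, 1%R[]).
    by rewrite lebesgue_measure_itv /= lte_fin ltr01 oppr0 addr0.
  by apply/seteqP; split=> x /=; rewrite in_itv.
pose X (x : measurableTypeR R) : trajectories G := fun i => r (nth_digit q i x).
have mX : measurable_fun setT X.
  apply: measurable_into_trajectories => i B.
  exact: (measurable_nth_digit q_mass i [set k | B (r k)]).
exists (distribution (as_probability mass1)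
  (mfun_Sub (mem_set mX : X \in mfun))) => n A.
have := lebesgue_digits q_mass n (fun i => [set k | A i (r k)]) 0%R ltr01.
rewrite mul1e => e; under [RHS]eq_bigr => i _ do rewrite muE.
rewrite -e; congr (lebesgue_measure _).
by apply/seteqP; split=> x /=; rewrite add0r subr0 divr1 => -[].
Qed.

End iid_existence.

(** * Projections and the theorem *)

Section projection.
Context {R : realType} {H G : groupType}.
Variable pi : H -> G.
Hypothesis piM : forall x y, pi (x * y)%g = (pi x * pi y)%g.
Hypotheses (countH : countable [set: H]) (countG : countable [set: G]).
Variables (nu : probability (discrete_group H) R)
  (mu : probability (discrete_group G) R).
Hypothesis marginal : forall A : set (discrete_group G), mu A = nu (pi @^-1` A).

Definition project (h : trajectories H) : trajectories G := fun n => pi (h n).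

Lemma measurable_project : measurable_fun setT project.
Proof.
apply: measurable_into_trajectories => n B.
exact: (measurable_coordinate n [set x | B (pi x)]).
Qed.

Lemma project_walk h : project (walk h) = walk (project h).
Proof.
apply/funext => t; rewrite /project /walk.
elim: t => [|t IH]; first by rewrite !big_ord0 (morph1 piM).
by rewrite !big_ord_recr /= piM IH.
Qed.

Definition projected_law (Q : probability (trajectories H) R) :
    probability (trajectories G) R :=
  distribution Q (mfun_Sub (mem_set measurable_project : project \in mfun)).

Lemma iid_project Q : iid_law nu Q -> iid_law mu (projected_law Q).
Proof.
move=> iid n A; have := iid n (fun i => pi @^-1` A i).
by under eq_bigr => i _ do rewrite -marginal.
Qed.

Lemma step_mass_image : is_image pi (step_mass nu) (step_mass mu).
Proof.
move=> t; rewrite step_massE marginal (measure_step_mass countH).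
apply: eq_esum => x _; rewrite (_ : (x \in _) = (pi x == t)) //.
by apply/idP/eqP; rewrite inE.
Qed.

(** The increments with law nu project to increments with law mu, and a
shift-invariant set of trajectories in G pulls back to a shift-invariant set of
trajectories in H. *)
Lemma Liouville_image : Liouville nu -> Liouville mu.
Proof.
move=> Lnu Q iid A mA invA.
have [P iidP] := iid_exists countH nu.
have mwA : measurable (@walk G @^-1` A).
  by rewrite -walk_from1; exact: measurable_walk_from_preimage.
have -> : pushforward Q (@walk G) A = pushforward P (@walk H) (project @^-1` A).
  transitivity (projected_law P (@walk G @^-1` A)).
    apply: trajectory_measure_unique mwA => [n B|]; last first.
      by apply: le_lt_trans (probability_le1 Q measurableT) (ltry _).
    exact: (etrans (iid n B) (esym (iid_project iidP n B))).
  congr (P _); apply/seteqP; split=> h /=; rewrite -project_walk //.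
apply: (Lnu P iidP); last by rewrite -[in RHS]invA.
by rewrite -[X in measurable X]setTI; exact: measurable_project.
Qed.

Lemma trivial_harmonic_image (Q : probability (trajectories H) R) :
  iid_law nu Q -> Liouville mu -> trivial_harmonic (step_mass mu).
Proof.
move=> iid Lmu.
exact: trivial_harmonic_of_zero_one (iid_project iid) (Lmu _ (iid_project iid)).
Qed.

End projection.

Lemma entropyE {R : realType} {G : groupType} (mu : probability (discrete_group G) R) :
  entropy mu = ent (step_mass mu).
Proof.
apply: eq_esum => x _; rewrite -step_massE.
have [->|px] := eqVneq (step_mass mu x) 0%R; first by rewrite mul0e mul0r oppr0 oppe0.
by rewrite lne_EFin // lt_neqAle eq_sym px step_mass_ge0.
Qed.

Theorem proposition21 (R : realType) (G G' : groupType)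
    (countG : countable [set: G]) (countG' : countable [set: G'])
    (mut : probability (discrete_group (G * G')%type) R)
    (mu : probability (discrete_group G) R) (mu' : probability (discrete_group G') R)
    (marginal : forall A : set (discrete_group G),
      mu A = pushforward mut (fst : discrete_group (G * G')%type -> discrete_group G) A)
    (marginal' : forall A : set (discrete_group G'),
      mu' A = pushforward mut (snd : discrete_group (G * G')%type -> discrete_group G') A)
    (finite_entropy : entropy mut < +oo) :
  Liouville mut <-> Liouville mu /\ Liouville mu'.
Proof.
have countGG : countable [set: G * G'] by rewrite -setXTT; exact: countableX.
have fstM (x y : G * G') : (x * y)%g.1 = (x.1 * y.1)%g by [].
have sndM (x y : G * G') : (x * y)%g.2 = (x.2 * y.2)%g by [].
split=> [L|[L L'] Q iid A mA invA].
  split; first exact: (Liouville_image fstM countGG countG marginal L).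
  exact: (Liouville_image sndM countGG countG' marginal' L).
apply: (shift_invariant_zero_one countGG iid) => //.
have mass := step_mass_mass countGG mut.
apply: (trivial_harmonic_product mass
  (step_mass_image countGG marginal) (step_mass_image countGG marginal')).
- by rewrite -entropyE.
- exact: (trivial_harmonic_image countG marginal iid L).
- exact: (trivial_harmonic_image countG' marginal' iid L').
Qed.
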